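(* There is an FP+Card formula which, on square integer matrices $M$ represented as structures (as described in the context), defines ''$M$ is non-singular'', i.e., holds exactly when $\det M\neq 0$.
   Context: An $I$-square integer matrix $M:I\times I\to\mathbb Z$ is represented as a two-sorted structure with sorts $I$ and $\{\hat0,\hat1,\dots,\hat k\}$, with the relations: the linear ordering $\hat0<\hat1<\dots<\hat k$ on the second sort; the ternary relation $M(i,j,\hat s)$ meaning ''the coefficient of $2^s$ in the binary expansion of the absolute value of the $(i,j)$ entry of $M$ is $1$''; and the binary relation ''the $(i,j)$ entry of $M$ is positive''. The determinant is computed after choosing any linear ordering of $I$ for both rows and columns and is independent of the choice. FP+Card: each input structure with universe $A$ is extended by a numerical sort $\{0,\dots,|A|\}$ with successor; formulas are first-order formulas extended by the inflationary fixpoint operator (on any sorts) and counting terms $(\sharp x)\varphi(x)$. *)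

(* Defs.v *)
From HB Require Import structures.
From mathcomp Require Import all_boot all_order all_fingroup all_algebra.

Set Implicit Arguments.
Unset Strict Implicit.
Unset Printing Implicit Defensive.

Fixpoint stuple (S : Type) (D : S -> finType) (ss : seq S) : finType :=
  if ss is s :: ss' then (D s * stuple D ss')%type : finType
  else unit : finType.

Fixpoint stuple_cat (S : Type) (D : S -> finType) (ss ts : seq S) :
    stuple D ss -> stuple D ts -> stuple D (ss ++ ts) :=
  match ss return stuple D ss -> stuple D ts -> stuple D (ss ++ ts) with
  | [::] => fun _ w => w
  | s :: ss' => fun v w => (v.1, stuple_cat v.2 w)
  end.

(* De Bruijn indices: [var ss s] is the type of positions of [s] in [ss]. *)
Inductive var (S : Type) (s : S) : seq S -> Type :=
| VHere ss : var s (s :: ss)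
| VThere t ss : var s ss -> var s (t :: ss).
Arguments VHere {S s ss}.
Arguments VThere {S s t ss} x.

Fixpoint lookup (S : Type) (D : S -> finType) (s : S) (ss : seq S)
    (x : var s ss) : stuple D ss -> D s :=
  match x in var _ ss0 return stuple D ss0 -> D s with
  | VHere _ => fun v => v.1
  | VThere _ _ y => fun v => lookup y v.2
  end.

Record vocabulary := Vocabulary {
  vsort : finType;
  vrel : Type;
  varity : vrel -> seq vsort }.

Record structure (V : vocabulary) := Structure {
  carrier : vsort V -> finType;
  interp : forall R : vrel V, pred (stuple carrier (varity R)) }.

(* Cardinality of the universe, i.e. of the disjoint union of all sorts. *)
Definition universe_card (V : vocabulary) (A : structure V) : nat :=
  \sum_(s : vsort V) #|carrier A s|.

(* The sorts of the extended structure: [Some s] for the sorts [s] of the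
   input structure, [None] for the numerical sort {0, ..., |A|}. *)
Definition xsort (V : vocabulary) := option (vsort V).

Definition dom (V : vocabulary) (A : structure V) (s : xsort V) : finType :=
  if s is Some s' then carrier A s' else 'I_(universe_card A).+1 : finType.

Fixpoint input_tuple (V : vocabulary) (A : structure V) (ss : seq (vsort V)) :
    stuple (dom A) (map Some ss) -> stuple (carrier A) ss :=
  match ss return stuple (dom A) (map Some ss) -> stuple (carrier A) ss with
  | [::] => fun v => v
  | s :: ss' => fun v => (v.1, @input_tuple V A ss' v.2)
  end.

Section Syntax.
Variable V : vocabulary.

(* [G] lists the sorts of the element variables in scope and [X] the arities
   of the relation variables in scope.  The most recently bound variable comes
   first.  In [Ifp ss phi ts], that is [IFP_(R, x) phi](ts), the formula [phi]
   may use the relation variable R of arity [ss], the variables x of sorts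
   [ss], and all the variables already in scope as parameters.  A counting term
   counts elements of a sort of the input structure. *)
Inductive term (G : seq (xsort V)) (X : seq (seq (xsort V))) :
    xsort V -> Type :=
| Var s : var s G -> term G X s
| Card (s : vsort V) : formula (Some s :: G) X -> term G X None

with terms (G : seq (xsort V)) (X : seq (seq (xsort V))) :
    seq (xsort V) -> Type :=
| TNil : terms G X [::]
| TCons s ss : term G X s -> terms G X ss -> terms G X (s :: ss)

with formula (G : seq (xsort V)) (X : seq (seq (xsort V))) : Type :=
| Eq s : term G X s -> term G X s -> formula G X
| Rel (R : vrel V) : terms G X (map Some (varity R)) -> formula G X
| Succ : term G X None -> term G X None -> formula G X
| RVar ss : var ss X -> terms G X ss -> formula G X
| Not : formula G X -> formula G X
| And : formula G X -> formula G X -> formula G X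
| Or : formula G X -> formula G X -> formula G X
| Ex (s : xsort V) : formula (s :: G) X -> formula G X
| All (s : xsort V) : formula (s :: G) X -> formula G X
| Ifp (ss : seq (xsort V)) :
    formula (ss ++ G) (ss :: X) -> terms G X ss -> formula G X.

Definition sentence : Type := formula [::] [::].

End Syntax.

(* The inflationary fixpoint of [F]: the stages of [Y |-> Y :|: F Y], started
   at the empty set, are stationary after at most [#|T|] steps; see [ifpP]. *)
Definition ifp_stage (T : finType) (F : {set T} -> {set T}) (n : nat) :
  {set T} := iter n (fun Y => Y :|: F Y) set0.

Definition ifp (T : finType) (F : {set T} -> {set T}) : {set T} :=
  ifp_stage F #|T|.

Section Semantics.
Variables (V : vocabulary) (A : structure V).

Definition rel_dom (ss : seq (xsort V)) : finType :=
  {set stuple (dom A) ss} : finType.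

(* The value of a counting term is at most [universe_card A], by [count_le],
   so that [inord] does not truncate. *)
Fixpoint eval_term G X s (t : term G X s) :
    stuple (dom A) G -> stuple rel_dom X -> dom A s :=
  match t in term _ _ s0
    return stuple (dom A) G -> stuple rel_dom X -> dom A s0 with
  | Var s x => fun v r => lookup x v
  | Card s phi => fun v r =>
      inord #|[set a : carrier A s |
                 eval (phi : formula (Some s :: G) X) (a, v) r]|
  end

with eval_terms G X ss (ts : terms G X ss) :
    stuple (dom A) G -> stuple rel_dom X -> stuple (dom A) ss :=
  match ts in terms _ _ ss0
    return stuple (dom A) G -> stuple rel_dom X -> stuple (dom A) ss0 with
  | TNil => fun v r => tt
  | TCons s ss t ts' => fun v r => (eval_term t v r, eval_terms ts' v r)
  end

with eval G X (phi : formula G X) :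
    stuple (dom A) G -> stuple rel_dom X -> bool :=
  match phi with
  | Eq s t u => fun v r => eval_term t v r == eval_term u v r
  | Rel R ts => fun v r => interp (input_tuple (eval_terms ts v r))
  | Succ t u => fun v r =>
      (eval_term u v r : 'I_(universe_card A).+1) ==
      (eval_term t v r : 'I_(universe_card A).+1).+1 :> nat
  | RVar ss x ts => fun v r =>
      eval_terms ts v r \in (lookup x r : {set stuple (dom A) ss})
  | Not psi => fun v r => ~~ eval psi v r
  | And psi chi => fun v r => eval psi v r && eval chi v r
  | Or psi chi => fun v r => eval psi v r || eval chi v r
  | Ex s psi => fun v r =>
      [exists a : dom A s, eval (psi : formula (s :: G) X) (a, v) r]
  | All s psi => fun v r =>
      [forall a : dom A s, eval (psi : formula (s :: G) X) (a, v) r]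
  | Ifp ss psi ts => fun v r =>
      eval_terms ts v r \in
        ifp (fun Y : {set stuple (dom A) ss} =>
               [set w | eval (psi : formula (ss ++ G) (ss :: X))
                             (stuple_cat w v) (Y, r)])
  end.

Definition satisfies (phi : sentence V) : bool := eval phi tt tt.

End Semantics.

Lemma ifp_stage_mono (T : finType) (F : {set T} -> {set T}) m n :
  m <= n -> ifp_stage F m \subset ifp_stage F n.
Proof.
move=> /subnK <-; elim: (n - m) => // d IHd.
by rewrite addSn; apply: subset_trans IHd _; rewrite subsetUl.
Qed.

Lemma ifp_stationary (T : finType) (F : {set T} -> {set T}) n :
  #|T| <= n -> ifp_stage F n = ifp F.
Proof.
pose st := ifp_stage F.
have fixS m : st m.+1 = st m -> forall d, st (d + m) = st m.
  move=> e; elim=> // d IHd.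
  by rewrite addSn -[RHS]e /st /ifp_stage !iterS -!/(ifp_stage F _) -!/(st _) IHd.
have grow m : (exists2 i, i < m & st i.+1 = st i) \/ m <= #|st m|.
  elim: m => [|m [[i lim e]|IHm]]; first by right.
    by left; exists i => //; apply: ltnW.
  have [e|ne] := eqVneq (st m.+1) (st m); first by left; exists m.
  right; apply: leq_ltn_trans IHm _; apply: proper_card.
  by rewrite properEneq eq_sym ne; apply: ifp_stage_mono.
have [[i lti e]|] := grow #|T|.+1; last by rewrite leqNgt ltnS max_card.
move=> leTn; have lein := leq_trans lti (leTn : #|T| < n.+1).
rewrite /ifp -/(st _) -/(st _) -(subnK (lein : i <= n)) fixS //.
by rewrite -(subnK (lti : i <= #|T|)) fixS.
Qed.

Lemma ifpP (T : finType) (F : {set T} -> {set T}) (x : T) :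
  reflect (exists n, x \in ifp_stage F n) (x \in ifp F).
Proof.
apply: (iffP idP) => [|[n xn]]; first by exists #|T|.
rewrite -(ifp_stationary F (leq_maxl #|T| n)).
exact: subsetP (ifp_stage_mono F (leq_maxr _ _)) _ xn.
Qed.

Lemma count_le (V : vocabulary) (A : structure V) (s : vsort V)
  (B : {set carrier A s}) : #|B| <= universe_card A.
Proof.
apply: leq_trans (max_card _) _.
by rewrite /universe_card (bigD1 s) //= leq_addr.
Qed.

Inductive mxsort := IndexSort | BitSort.

Definition mxsort_to_bool (s : mxsort) := if s is BitSort then true else false.
Definition mxsort_of_bool (b : bool) := if b then BitSort else IndexSort.
Lemma mxsort_to_boolK : cancel mxsort_to_bool mxsort_of_bool.
Proof. by case. Qed.
HB.instance Definition _ := Finite.copy mxsort (can_type mxsort_to_boolK).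

Inductive mxrel := BitLt | BitOf | Positive.

Definition mxarity (R : mxrel) : seq mxsort :=
  match R with
  | BitLt => [:: BitSort; BitSort]
  | BitOf => [:: IndexSort; IndexSort; BitSort]
  | Positive => [:: IndexSort; IndexSort]
  end.

Definition mxvoc : vocabulary := @Vocabulary mxsort mxrel mxarity.

Definition binary_digit (m s : nat) : bool := odd (m %/ 2 ^ s).

Section MatrixStructure.
Variables (I : finType) (k : nat) (M : I -> I -> int).

Definition mxcarrier (s : mxsort) : finType :=
  match s with IndexSort => I | BitSort => 'I_k.+1 : finType end.

Definition mxinterp (R : mxrel) : pred (stuple mxcarrier (mxarity R)) :=
  match R return pred (stuple mxcarrier (mxarity R)) with
  | BitLt => fun v => let: (s, (t, _)) := v in (s : 'I_k.+1) < (t : 'I_k.+1)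
  | BitOf => fun v => let: (i, (j, (s, _))) := v in
                      binary_digit `|M i j|%N (s : 'I_k.+1)
  | Positive => fun v => let: (i, (j, _)) := v in (0 < M i j)%R
  end.

Definition mxstructure : structure mxvoc := @Structure mxvoc mxcarrier mxinterp.

(* The bits 0, ..., k suffice to write down every entry. *)
Definition bits_suffice : Prop := forall i j : I, `|M i j|%N < 2 ^ k.+1.

End MatrixStructure.

(* The determinant with respect to the linear ordering of [I] given by its
   enumeration; by [idet_indep] any other ordering gives the same value. *)
Definition idet (I : finType) (M : I -> I -> int) : int :=
  (\det (\matrix_(i < #|I|, j < #|I|) M (enum_val i) (enum_val j)))%R.

Lemma idet_indep (I : finType) (M : I -> I -> int) (n : nat) (f : 'I_n -> I) :
  bijective f -> (\det (\matrix_(i < n, j < n) M (f i) (f j)))%R = idet M.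
Proof.
move=> bf; have := bij_eq_card bf; rewrite card_ord => e.
rewrite /idet; move: (@enum_val_bij I); move: (@enum_val I predT).
change #|predT| with #|I|; rewrite -e => g [h hK gK].
have inj : injective (h \o f).
  by apply: inj_comp (bij_inj bf); apply: can_inj gK.
pose s := perm inj; set B := (\matrix_(i, j) M (g i) (g j))%R.
have -> : (\matrix_(i, j) M (f i) (f j))%R = row_perm s (col_perm s B).
  by apply/matrixP=> i j; rewrite !mxE !permE /= !gK.
rewrite row_permE col_permE !det_mulmx !det_perm GRing.mulrCA -GRing.signr_addb.
by rewrite odd_permV addbb GRing.mulr1.
Qed.

(* Main.v *)
Require Import Defs.
From mathcomp Require Import all_boot all_order all_algebra.
From mathcomp Require Import perm ring zify.

(** Over Z, the division-free form of the Faddeev-LeVerrier recursion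
      Y_0 = M,   Y_(t+1) = (t+1) M Y_t - tr(Y_t) M
    gives Y_(n-1) = +-(n-1)! det(M) 1 for n = #|I| > 0.  Only matrix products
    and traces occur in it, so no ordering of I is needed.  With b = |A| + 1,
    triples over the numerical sort encode the numbers below b^3.  By the
    harmonic triangle of Leibniz, a nonzero common multiple of 1, ..., b^3
    exceeds every entry of Y_(n-1), so M is singular iff for some i the entry
    (i, i) of Y_(n-1) vanishes modulo every m <= b^3 (when I is empty there is
    no such i).  Modulo m the recursion is an inflationary fixpoint over numbers
    below b^3: a sum over I of values below m becomes, by grouping equal values,
    an ordered sum of the terms v * #{a | value of a is v}, and counting terms
    supply the cardinals. *)

Set Implicit Arguments.
Unset Strict Implicit.
Unset Printing Implicit Defensive.


(** * Renaming of variables in formulas *)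

(** Elimination meets two obstacles: a formula cannot single out a pivot row of the unordered [I],
    and modulo a composite number a nonzero pivot need not be invertible. The second also rules out
    the usual form of the recursion, which divides a trace by t; multiplying through by t! removes
    the division. The remaining factor (n-1)! may vanish modulo many m. This is harmless: the
    residues serve only together, to decide whether one fixed integer is zero, and over Z the factor
    is nonzero. Testing all moduli rather than primes avoids both primality and the Chinese
    remainder theorem.

    No formula is written out in full. Definability is proved through closure properties of semantic
    predicates and of number-valued functions, each yielding a formula that is uniform in the
    structure; the handling of De Bruijn variables is confined to renamings. *)

Section Renaming.
Variable S : Type.

Definition ren (ss ts : seq S) := forall s, var s ss -> var s ts.


(** Inversion of a variable over a nonempty scope, for an arbitrary type of sorts: the coincidence
    of [s] and [t] stays a proof to transport along. It is transparent so that [ren_case] computes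
    on constructors. *)
Definition var_case (s t : S) (ss : seq S) (Q : var s (t :: ss) -> Type)
    (H0 : forall e : s = t, Q (eq_rect_r (fun u => var u (t :: ss)) VHere e))
    (H1 : forall y, Q (VThere y)) (x : var s (t :: ss)) : Q x.
Proof.
refine (match x as x0 in var _ l return
  (match l as l0 return var s l0 -> Type with
   | [::] => fun _ => unit
   | t' :: ss' => fun x0 => forall Q : var s (t' :: ss') -> Type,
      (forall e : s = t', Q (eq_rect_r (fun u => var u (t' :: ss')) VHere e)) ->
      (forall y, Q (VThere y)) -> Q x0
   end) x0 with VHere _ => fun Q H0 _ => H0 erefl
   | VThere _ _ y => fun Q _ H1 => H1 y end Q H0 H1).
Defined.

Lemma varP (s t : S) (ss : seq S) (x : var s (t :: ss)) :
  (exists e : s = t, x = eq_rect_r (fun u => var u (t :: ss)) VHere e) \/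
  exists y, x = VThere y.
Proof.
by apply: (var_case (Q := fun x => _ \/ _)) x; [left; exists e | right; exists y].
Qed.

Definition ren_case (s : S) (ss ts : seq S) (h : var s ts) (f : ren ss ts) :
  ren (s :: ss) ts :=
  fun t x => var_case (Q := fun _ => var t ts) (fun e => eq_rect_r (fun u => var u ts) h e) (f t) x.

Definition ren_nil (ts : seq S) : ren [::] ts := fun s x =>
  match x in var _ l return
     if l is [::] then var s ts else unit with VHere _ => tt | VThere _ _ _ => tt end.
Arguments ren_nil ts : clear implicits.

Definition ren_there (s : S) (ss ts : seq S) (f : ren ss ts) : ren ss (s :: ts) :=
  fun t x => VThere (f t x).

Definition ren_lift (s : S) (ss ts : seq S) (f : ren ss ts) :
  ren (s :: ss) (s :: ts) := ren_case VHere (ren_there s f).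

Fixpoint ren_liftn (us : seq S) (ss ts : seq S) (f : ren ss ts) :
    ren (us ++ ss) (us ++ ts) :=
  match us return ren (us ++ ss) (us ++ ts) with
  | [::] => f
  | s :: us' => ren_lift (@ren_liftn us' _ _ f)
  end.
Arguments ren_liftn us {ss ts} f.

Variable D : S -> finType.

Definition compat (ss ts : seq S) (f : ren ss ts) (w : stuple D ts) (v : stuple D ss) :=
  forall s (x : var s ss), lookup (f s x) w = lookup x v.

Lemma compat_case s ss ts (h : var s ts) (f : ren ss ts) w v :
  compat f w v -> compat (ren_case h f) w ((lookup h w, v) : stuple D (s :: ss)).
Proof.
move=> cf t x; case: (varP x) => [[e ->]|[y ->]]; last exact: cf.
by move: x; case: s / e h => h x.
Qed.

Lemma compat_there s ss ts (f : ren ss ts) (a : D s) w v :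
  compat f w v -> compat (ren_there s f) ((a, w) : stuple D (s :: ts)) v.
Proof. by move=> cf t x; apply: cf. Qed.

Lemma compat_lift s ss ts (f : ren ss ts) (a : D s) w v :
  compat f w v ->
  compat (ren_lift f) ((a, w) : stuple D (s :: ts)) ((a, v) : stuple D (s :: ss)).
Proof.
by move=> cf; apply: (@compat_case _ _ _ VHere _ (a, w)); apply: compat_there.
Qed.

Lemma compat_liftn us ss ts (f : ren ss ts) (u : stuple D us) w v :
  compat f w v -> compat (ren_liftn us f) (stuple_cat u w) (stuple_cat u v).
Proof. by move=> cf; elim: us u => //= s us IH u; apply: compat_lift. Qed.

Lemma compat_nil ts (w : stuple D ts) : compat (ren_nil ts) w tt.
Proof.
move=> s x; have F : False.
  exact: (match x in var _ l return if l is [::] then False else unit with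
          VHere _ => tt | VThere _ _ _ => tt end).
by case: F.
Qed.

Definition stuple_hd ss ts (w : stuple D (ss ++ ts)) : stuple D ss :=
  (fix go ss : stuple D (ss ++ ts) -> stuple D ss :=
   match ss return stuple D (ss ++ ts) -> stuple D ss with
   | [::] => fun _ => tt
   | s :: ss' => fun w => (w.1, go ss' w.2) end) ss w.

Definition stuple_tl ss ts (w : stuple D (ss ++ ts)) : stuple D ts :=
  (fix go ss : stuple D (ss ++ ts) -> stuple D ts :=
   match ss return stuple D (ss ++ ts) -> stuple D ts with
   | [::] => fun w => w
   | s :: ss' => fun w => go ss' w.2 end) ss w.

Lemma stuple_hdK ss ts (u : stuple D ss) (w : stuple D ts) :
  stuple_hd (stuple_cat u w) = u.
Proof. by elim: ss u => [[] //|s ss IH [a u] /=]; rewrite IH. Qed.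

Lemma stuple_tlK ss ts (u : stuple D ss) (w : stuple D ts) :
  stuple_tl (stuple_cat u w) = w.
Proof. by elim: ss u => [//|s ss IH [a u]]; exact: IH. Qed.

Lemma stuple_cat_hdtl ss ts (w : stuple D (ss ++ ts)) :
  stuple_cat (stuple_hd w) (stuple_tl w) = w.
Proof. by elim: ss w => [//|s ss IH [a w] /=]; rewrite IH. Qed.

Fixpoint ren_catl (ss ts : seq S) : ren ss (ss ++ ts) :=
  match ss return ren ss (ss ++ ts) with
  | [::] => ren_nil ts
  | s :: ss' => ren_lift (@ren_catl ss' ts)
  end.
Arguments ren_catl : clear implicits.

Fixpoint ren_catr (ss ts : seq S) : ren ts (ss ++ ts) :=
  match ss return ren ts (ss ++ ts) with
  | [::] => fun _ x => x
  | s :: ss' => ren_there s (@ren_catr ss' ts)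
  end.
Arguments ren_catr : clear implicits.

Lemma compat_catl ss ts (w : stuple D (ss ++ ts)) : compat (ren_catl ss ts) w (stuple_hd w).
Proof.
elim: ss w => [|s ss IH] w; first exact: compat_nil.
by case: w => a w; apply: compat_lift.
Qed.

Lemma compat_catr ss ts (w : stuple D (ss ++ ts)) : compat (ren_catr ss ts) w (stuple_tl w).
Proof. by elim: ss w => [//|s ss IH [a w] t x]; apply: IH. Qed.

Fixpoint ren_cat (ss us ts : seq S) : ren ss ts -> ren us ts -> ren (ss ++ us) ts :=
  match ss return ren ss ts -> ren us ts -> ren (ss ++ us) ts with
  | [::] => fun _ g => g
  | s :: ss' => fun f g => ren_case (f s VHere) (ren_cat (fun t x => f t (VThere x)) g)
  end.

Lemma compat_cat ss us ts (f : ren ss ts) (g : ren us ts) w v u :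
  compat f w v -> compat g w u -> compat (ren_cat f g) w (stuple_cat v u).
Proof.
elim: ss f v => [//|s ss IH] f [a v] cf cg /=.
have := cf s VHere => /= <-; apply: compat_case; apply: IH => // t x.
Qed.

Lemma compat_comp ss us ts (f : ren ss us) (g : ren us ts) w u v :
  compat g w u -> compat f u v -> compat (fun s x => g s (f s x)) w v.
Proof. by move=> cg cf s x; rewrite cg cf. Qed.

End Renaming.
Arguments ren_nil {S} ts.
Arguments ren_liftn {S} us {ss ts} f.
Arguments ren_catl {S} ss ts.
Arguments ren_catr {S} ss ts.

Scheme term_mut := Induction for term Sort Prop
with terms_mut := Induction for terms Sort Prop
with formula_mut := Induction for formula Sort Prop.

Lemma eq_ifp (T : finType) (F F' : {set T} -> {set T}) :
  F =1 F' -> ifp F = ifp F'.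
Proof. by move=> e; apply: eq_iter => Y; rewrite e. Qed.

Section RenameExists.
Variable V : vocabulary.

Definition term_renamable G X s (t : @term V G X s) := forall G' X' (f : ren G G') (g : ren X X'),
  exists t' : term G' X' s, forall (A : structure V) v v' r r',
    compat (D := dom A) f v' v -> compat (D := rel_dom A) g r' r ->
    eval_term t' v' r' = eval_term t v r.

Definition terms_renamable G X ss (t : @terms V G X ss) := forall G' X' (f : ren G G') (g : ren X X'),
  exists t' : terms G' X' ss, forall (A : structure V) v v' r r',
    compat (D := dom A) f v' v -> compat (D := rel_dom A) g r' r ->
    eval_terms t' v' r' = eval_terms t v r.

Definition formula_renamable G X (p : @formula V G X) := forall G' X' (f : ren G G') (g : ren X X'),
  exists p' : formula G' X', forall (A : structure V) v v' r r',
    compat (D := dom A) f v' v -> compat (D := rel_dom A) g r' r ->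
    eval p' v' r' = eval p v r.

(** One mutual induction over the syntax produces the renamed formula together with its semantics.
    Binders lift the renaming of element variables, and [Ifp] lifts both renamings. *)
Lemma rename_formula G X (p : @formula V G X) : formula_renamable p.
Proof.
apply (@formula_mut V term_renamable terms_renamable formula_renamable) => {G X p}.
- by move=> G X s x G' X' f g; exists (Var X' (f s x)) => A v v' r r' cf _; apply: cf.
- move=> G X s p IH G' X' f g.
  have [p' h] := IH _ _ (ren_lift f) g.
  exists (Card p') => A v v' r r' cf cg /=; congr (inord #|pred_of_set _|).
  by apply/setP => a; rewrite !inE; apply: h => //; apply: compat_lift.
- by move=> G X G' X' f g; exists (TNil _ _).
- move=> G X s ss t IHt ts IHts G' X' f g.
  have [t' ht] := IHt _ _ f g; have [ts' hts] := IHts _ _ f g.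
  by exists (TCons t' ts') => A v v' r r' cf cg /=; rewrite (ht A v v' r r') // (hts A v v' r r').
- move=> G X s t IHt u IHu G' X' f g.
  have [t' ht] := IHt _ _ f g; have [u' hu] := IHu _ _ f g.
  by exists (Eq t' u') => A v v' r r' cf cg /=; rewrite (ht A v v' r r') // (hu A v v' r r').
- move=> G X R ts IH G' X' f g; have [ts' h] := IH _ _ f g.
  by exists (Rel ts') => A v v' r r' cf cg /=; rewrite (h A v v' r r').
- move=> G X t IHt u IHu G' X' f g.
  have [t' ht] := IHt _ _ f g; have [u' hu] := IHu _ _ f g.
  by exists (Succ t' u') => A v v' r r' cf cg /=; rewrite (ht A v v' r r') // (hu A v v' r r').
- move=> G X ss x ts IH G' X' f g; have [ts' h] := IH _ _ f g.
  by exists (RVar (g _ x) ts') => A v v' r r' cf cg /=; rewrite (h A v v' r r') // cg.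
- move=> G X p IH G' X' f g; have [p' h] := IH _ _ f g.
  by exists (Not p') => A v v' r r' cf cg /=; rewrite (h A v v' r r').
- move=> G X t IHt u IHu G' X' f g.
  have [t' ht] := IHt _ _ f g; have [u' hu] := IHu _ _ f g.
  by exists (And t' u') => A v v' r r' cf cg /=; rewrite (ht A v v' r r') // (hu A v v' r r').
- move=> G X t IHt u IHu G' X' f g.
  have [t' ht] := IHt _ _ f g; have [u' hu] := IHu _ _ f g.
  by exists (Or t' u') => A v v' r r' cf cg /=; rewrite (ht A v v' r r') // (hu A v v' r r').
- move=> G X s p IH G' X' f g; have [p' h] := IH _ _ (ren_lift f) g.
  exists (Ex p') => A v v' r r' cf cg /=; apply: eq_existsb => a.
  by apply: h => //; apply: compat_lift.
- move=> G X s p IH G' X' f g; have [p' h] := IH _ _ (ren_lift f) g.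
  exists (All p') => A v v' r r' cf cg /=; apply: eq_forallb => a.
  by apply: h => //; apply: compat_lift.
- move=> G X ss p IHp ts IHts G' X' f g.
  have [p' hp] := IHp _ _ (ren_liftn ss f) (ren_lift g).
  have [ts' hts] := IHts _ _ f g.
  exists (Ifp p' ts') => A v v' r r' cf cg /=; rewrite (hts A v v' r r') //.
  congr (_ \in pred_of_set _); apply: eq_ifp => Y; apply/setP => w; rewrite !inE.
  by apply: hp; [apply: compat_liftn | apply: compat_lift].
Qed.

End RenameExists.

(** * Definability relative to a semantic context *)
Section Contexts.
Variable V : vocabulary.
Implicit Type A : structure V.

(* A syntactic scope together with a type [cE] of semantic environments; [cok]
   selects the environments in which a formula is required to be correct.
   Properties and functions below are functions of [cE C A], so that variables
   are projections and no De Bruijn index is written. *)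
Record ctx := Ctx {
  cG : seq (xsort V);
  cX : seq (seq (xsort V));
  cE : structure V -> Type;
  cv : forall A, cE A -> stuple (dom A) cG;
  cr : forall A, cE A -> stuple (rel_dom A) cX;
  cok : forall A, cE A -> Prop }.

Definition cpred (C : ctx) := forall A, cE C A -> bool.
Definition cfun (C : ctx) := forall A, cE C A -> nat.
Definition cblk (C : ctx) ss := forall A, cE C A -> stuple (dom A) ss.
Definition cmap (C' C : ctx) := forall A, cE C' A -> cE C A.

(** The formula is chosen before the structure, so definability is uniform over all structures. *)
Definition definable (C : ctx) (P : cpred C) :=
  exists phi : formula (cG C) (cX C),
    forall A (e : cE C A), cok e -> eval phi (cv e) (cr e) = P A e.

Definition empty_ctx : ctx :=
  @Ctx [::] [::] (fun=> unit) (fun _ _ => tt) (fun _ _ => tt) (fun _ _ => True).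

Definition vars_ctx (ss : seq (xsort V)) (C : ctx) : ctx :=
  @Ctx (ss ++ cG C) (cX C) (fun A => stuple (dom A) ss * cE C A)%type
    (fun A e => stuple_cat e.1 (cv e.2)) (fun A e => cr e.2) (fun A e => cok e.2).

Definition rel_ctx (ss : seq (xsort V)) (C : ctx) : ctx :=
  @Ctx (cG C) (ss :: cX C) (fun A => {set stuple (dom A) ss} * cE C A)%type
    (fun A e => cv e.2) (fun A e => (e.1, cr e.2)) (fun A e => cok e.2).

Definition restrict_ctx (C : ctx) (ok : forall A, cE C A -> Prop) : ctx :=
  @Ctx (cG C) (cX C) (cE C) (@cv C) (@cr C) ok.

(** These are the maps of environments realized by a renaming; weakening, exchange and substitution
    of variables are all instances, stated through projections. *)
Definition ctx_mor (C' C : ctx) (m : cmap C' C) :=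
  exists (f : ren (cG C) (cG C')) (g : ren (cX C) (cX C')),
    forall A (e : cE C' A), cok e ->
      [/\ compat f (cv e) (cv (m A e)), compat g (cr e) (cr (m A e)) & cok (m A e)].

(** A block consists of variables only, not of compound terms, so that renaming alone can substitute
    it. *)
Definition var_block ss (C : ctx) (x : cblk C ss) :=
  exists f : ren ss (cG C), forall A (e : cE C A), cok e -> compat f (cv e) (x A e).

Lemma def_ext C (P Q : cpred C) :
  (forall A (e : cE C A), cok e -> P A e = Q A e) -> definable P -> definable Q.
Proof. by move=> PQ [p h]; exists p => A e ok; rewrite h ?PQ. Qed.

Lemma def_mor C' C (m : cmap C' C) (P : cpred C) :
  ctx_mor m -> definable P -> definable (C := C') (fun A e => P A (m A e)).
Proof.
move=> [f [g h]] [p hp]; have [p' hp'] := rename_formula p f g.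
by exists p' => A e ok; have [cf cg ok'] := h A e ok; rewrite (hp' A _ _ _ _ cf cg) hp.
Qed.

(** * Morphisms of contexts and blocks of variables *)

Lemma mor_id C : ctx_mor (C' := C) (C := C) (fun A e => e).
Proof. by exists (fun _ x => x), (fun _ x => x). Qed.

Lemma mor_comp C C' C'' (m : cmap C' C) (m' : cmap C'' C') :
  ctx_mor m -> ctx_mor m' -> ctx_mor (C' := C'') (fun A e => m A (m' A e)).
Proof.
move=> [f [g h]] [f' [g' h']].
exists (fun s x => f' s (f s x)), (fun s x => g' s (g s x)) => A e ok.
have [cf' cg' ok'] := h' A e ok; have [cf cg ok''] := h A _ ok'.
by split=> //; [apply: compat_comp cf' cf | apply: compat_comp cg' cg].
Qed.

Lemma mor_tl C ss : ctx_mor (C' := vars_ctx ss C) (C := C) (fun A e => e.2).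
Proof.
exists (ren_catr ss (cG C)), (fun _ x => x) => A e ok; split=> //.
by have := compat_catr (D := dom A) (ss := ss) (cv e); rewrite /= stuple_tlK.
Qed.

Lemma mor_rtl C ss : ctx_mor (C' := rel_ctx ss C) (C := C) (fun A e => e.2).
Proof.
exists (fun _ x => x), (ren_there ss (fun _ x => x)) => A e ok; split=> //.
Qed.

Lemma mor_rlift C' C (m : cmap C' C) ss : ctx_mor m ->
  ctx_mor (C' := rel_ctx ss C') (C := rel_ctx ss C) (fun A e => (e.1, m A e.2)).
Proof.
move=> [f [g h]]; exists f, (ren_lift g) => A e ok.
by have [cf cg ok'] := h A e.2 ok; split=> //; apply: compat_lift.
Qed.

Lemma mor_cons C' C (m : cmap C' C) ss (x : cblk C' ss) :
  ctx_mor m -> var_block x -> ctx_mor (C' := C') (C := vars_ctx ss C) (fun A e => (x A e, m A e)).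
Proof.
move=> [f [g h]] [k hk]; exists (ren_cat k f), g => A e ok.
by have [cf cg ok'] := h A e ok; split=> //; apply: compat_cat; first exact: hk.
Qed.

Lemma blk_mor C' C (m : cmap C' C) ss (x : cblk C ss) :
  ctx_mor m -> var_block x -> var_block (C := C') (fun A e => x A (m A e)).
Proof.
move=> [f [g h]] [k hk]; exists (fun s y => f s (k s y)) => A e ok.
by have [cf cg ok'] := h A e ok; apply: compat_comp cf _; apply: hk.
Qed.

Lemma blk_hd C ss : var_block (C := vars_ctx ss C) (fun A e => e.1).
Proof.
exists (ren_catl ss (cG C)) => A e ok.
by have := compat_catl (D := dom A) (ss := ss) (cv e); rewrite /= stuple_hdK.
Qed.

Lemma blk_nil C : var_block (C := C) (ss := [::]) (fun A e => tt).
Proof. by exists (ren_nil _) => A e ok; apply: compat_nil. Qed.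

Lemma blk_cat C ss ts (x : cblk C ss) (y : cblk C ts) :
  var_block x -> var_block y -> var_block (C := C) (ss := ss ++ ts) (fun A e => stuple_cat (x A e) (y A e)).
Proof.
move=> [f hf] [g hg]; exists (ren_cat f g) => A e ok.
by apply: compat_cat; [apply: hf | apply: hg].
Qed.

Lemma blk_take C ss ts (x : cblk C (ss ++ ts)) :
  var_block x -> var_block (C := C) (fun A e => stuple_hd (x A e)).
Proof.
move=> [f hf]; exists (fun s y => f s (ren_catl ss ts s y)) => A e ok.
by apply: compat_comp (hf A e ok) _; apply: compat_catl.
Qed.

Lemma blk_drop C ss ts (x : cblk C (ss ++ ts)) :
  var_block x -> var_block (C := C) (fun A e => stuple_tl (x A e)).
Proof.
move=> [f hf]; exists (fun s y => f s (ren_catr ss ts s y)) => A e ok.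
by apply: compat_comp (hf A e ok) _; apply: compat_catr.
Qed.

Lemma blk_head C s ss (x : cblk C (s :: ss)) :
  var_block x -> var_block (C := C) (ss := [:: s]) (fun A e => ((x A e).1, tt)).
Proof. exact: (@blk_take C [:: s] ss). Qed.

Lemma blk_tail C s ss (x : cblk C (s :: ss)) :
  var_block x -> var_block (C := C) (ss := ss) (fun A e => (x A e).2).
Proof. exact: (@blk_drop C [:: s] ss). Qed.

Lemma blk_terms C ss (x : cblk C ss) : var_block x ->
  exists ts : terms (cG C) (cX C) ss,
    forall A (e : cE C A), cok e -> eval_terms ts (cv e) (cr e) = x A e.
Proof.
elim: ss x => [|s ss IH] x bx.
  by exists (TNil _ _) => A e ok; case: (x A e).
have [ts hts] := IH _ (blk_tail bx); have [f hf] := bx.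
exists (TCons (Var _ (f s VHere)) ts) => A e ok /=.
by rewrite hts // (hf A e ok s VHere) -surjective_pairing.
Qed.

(** * Closure of definability under the constructors of the logic *)

Lemma def_const C (b : bool) : definable (C := C) (fun A e => b).
Proof.
have t : exists p : formula (cG C) (cX C), forall A v r, eval (A := A) p v r = true.
  (* The scope may be empty, so the variable has to be bound; the numerical sort is present over
     every vocabulary. *)
  exists (All (s := None) (Eq (Var _ VHere) (Var _ VHere))) => A v r.
  by apply/forallP => a /=.
have [p hp] := t; case: b; first by exists p => A e _; apply: hp.
by exists (Not p) => A e _ /=; rewrite hp.
Qed.

Lemma def_not C (P : cpred C) : definable P -> definable (C := C) (fun A e => ~~ P A e).
Proof. by move=> [p hp]; exists (Not p) => A e ok /=; rewrite hp. Qed.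

Lemma def_and C (P Q : cpred C) :
  definable P -> definable Q -> definable (C := C) (fun A e => P A e && Q A e).
Proof. by move=> [p hp] [q hq]; exists (And p q) => A e ok /=; rewrite hp ?hq. Qed.

Lemma def_or C (P Q : cpred C) :
  definable P -> definable Q -> definable (C := C) (fun A e => P A e || Q A e).
Proof. by move=> [p hp] [q hq]; exists (Or p q) => A e ok /=; rewrite hp ?hq. Qed.

Lemma eval_exs G X ss (p : formula (ss ++ G) X) :
  exists p' : formula G X, forall A v r,
    eval (A := A) p' v r = [exists w, eval p (stuple_cat w v) r].
Proof.
elim: ss p => [|s ss IH] p.
  exists p => A v r; apply/idP/existsP => [h|[[]]//]; by exists tt.
have [p' hp'] := IH (Ex p); exists p' => A v r; rewrite hp' /=.
apply/existsP/existsP => [[w /existsP[a h]]|[[a w] h]]; first by exists (a, w).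
by exists w; apply/existsP; exists a.
Qed.

Lemma def_ex C ss (P : cpred (vars_ctx ss C)) :
  definable P -> definable (C := C) (fun A e => [exists w, P A (w, e)]).
Proof.
move=> [p hp]; have [p' hp'] := eval_exs p; exists p' => A e ok.
by rewrite hp'; apply: eq_existsb => w; apply: (hp A (w, e)).
Qed.

Lemma def_all C ss (P : cpred (vars_ctx ss C)) :
  definable P -> definable (C := C) (fun A e => [forall w, P A (w, e)]).
Proof.
move=> hP; apply: def_ext (def_not (def_ex (def_not hP))) => A e _.
by rewrite negb_exists; apply: eq_forallb => w; rewrite negbK.
Qed.

Lemma def_eq1 C s (x y : cblk C [:: s]) : var_block x -> var_block y ->
  definable (C := C) (fun A e => (x A e).1 == (y A e).1).
Proof.
move=> [f hf] [g hg]; exists (Eq (Var _ (f s VHere)) (Var _ (g s VHere))) => A e ok /=.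
by rewrite (hf A e ok) (hg A e ok).
Qed.

Lemma def_succ1 C (x y : cblk C [:: None]) : var_block x -> var_block y ->
  definable (C := C) (fun A e => ((y A e).1 : 'I_(universe_card A).+1) ==
                           ((x A e).1 : 'I_(universe_card A).+1).+1 :> nat).
Proof.
move=> [f hf] [g hg]; exists (Succ (Var _ (f None VHere)) (Var _ (g None VHere))) => A e ok /=.
by rewrite (hf A e ok) (hg A e ok).
Qed.

Lemma def_rel C (R : vrel V) (x : cblk C (map Some (varity R))) : var_block x ->
  definable (C := C) (fun A e => interp (input_tuple (x A e))).
Proof. by move=> /blk_terms[ts h]; exists (Rel ts) => A e ok /=; rewrite h. Qed.


Lemma def_card_eq C s (P : cpred (vars_ctx [:: Some s] C)) (x : cblk C [:: None]) :
  definable P -> var_block x ->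
  definable (C := C) (fun A e => ((x A e).1 : 'I_(universe_card A).+1) ==
    #|[set a : carrier A s | P A (((a, tt) : stuple (dom A) [:: Some s]), e)]| :> nat).
Proof.
move=> [p hp] [f hf].
exists (Eq (Var _ (f None VHere)) (Card (s := s) p)) => A e ok /=.
rewrite (hf A e ok) -val_eqE /= inordK ?ltnS ?count_le //.
congr (_ == #|pred_of_set _|); apply/setP => a; rewrite !inE.
exact: (hp A ((a, tt), e)).
Qed.

Lemma def_ifp C ss (P : cpred (vars_ctx ss (rel_ctx ss C))) : definable P ->
  definable (C := vars_ctx ss C)
    (fun A e => e.1 \in ifp (fun Y => [set w | P A (w, (Y, e.2))])).
Proof.
move=> dP.
(* The arguments of the fixpoint are themselves variables in scope, so the body has to be weakened
   over them. *)
have [p hp] : definable (C := vars_ctx ss (rel_ctx ss (vars_ctx ss C)))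
    (fun A e => P A (e.1, (e.2.1, e.2.2.2))).
  apply: def_mor dP; apply: mor_cons; last exact: blk_hd.
  exact: mor_comp (mor_rlift _ (mor_tl _ _)) (mor_tl _ _).
have [ts hts] := blk_terms (@blk_hd C ss).
exists (Ifp p ts) => A e ok /=; rewrite hts //.
congr (_ \in pred_of_set _); apply: eq_ifp => Y; apply/setP => w; rewrite !inE.
exact: (hp A (w, (Y, e))).
Qed.

Lemma def_member C' C ss (m : cmap C' (rel_ctx ss C)) (x : cblk C' ss) :
  ctx_mor m -> var_block x -> definable (C := C') (fun A e => x A e \in (m A e).1).
Proof.
move=> [f [g h]] /blk_terms[ts hts]; exists (RVar (g _ VHere) ts) => A e ok /=.
by have [cf cg ok'] := h A e ok; rewrite hts // (cg _ VHere).
Qed.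

(* Outside the intended environments a formula still denotes some predicate. *)
Lemma def_relax C ok (P : cpred C) : definable (C := restrict_ctx (C := C) ok) P ->
  exists2 P' : cpred C, (forall A e, ok A e -> P' A e = P A e) & definable P'.
Proof.
by move=> [p hp]; exists (fun A e => eval p (cv e) (cr e)) => //; exists p.
Qed.

End Contexts.

(** * Numbers as triples over the numerical sort *)
Section Numbers.
Variable V : vocabulary.
Implicit Type A : structure V.
Implicit Type C : ctx V.

Definition base A := (universe_card A).+1.

Fixpoint dec A d : stuple (dom A) (nseq d None) -> nat :=
  match d return stuple (dom A) (nseq d None) -> nat with
  | 0 => fun _ => 0
  | d'.+1 => fun w => (w.1 : 'I_(universe_card A).+1) + base A * dec (d := d') w.2
  end.
Arguments dec A {d} w.

Lemma digit_lt A (a : dom A None) : (a : 'I_(universe_card A).+1) < base A.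
Proof. exact: ltn_ord. Qed.

Lemma dec_lt A d (w : stuple (dom A) (nseq d None)) : dec A w < base A ^ d.
Proof.
elim: d w => [//|d IH] [a w] /=.
have := IH w; have := digit_lt a; rewrite expnS; set b := base A => ha hw.
apply: (@leq_trans (b + b * dec A w)); first by rewrite ltn_add2r.
by rewrite -mulnS leq_mul2l hw orbT.
Qed.

Lemma dec_inj A d : injective (@dec A d).
Proof.
elim: d => [[] [] //|d IH] [a u] [c w] /= e.
have := digit_lt a; have := digit_lt c; move: e; rewrite ![base A * _]mulnC.
set b := base A => e hc ha.
have := congr1 (modn^~ b) e; rewrite ![_ + _ * b]addnC !modnMDl !modn_small // => eac.
have -> : a = c by apply: val_inj.
by congr (_, _); apply: IH; move/eqP: e; rewrite eac eqn_add2l eqn_mul2r => /eqP.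
Qed.

Lemma dec_surj A d n : n < base A ^ d -> exists w : stuple (dom A) (nseq d None), dec A w = n.
Proof.
elim: d n => [|d IH] n hn; first by exists tt; case: n hn.
have [w hw] : exists w : stuple (dom A) (nseq d None), dec A w = n %/ base A.
  by apply: IH; rewrite ltn_divLR // mulnC -expnS.
exists ((inord (n %% base A) : 'I_(universe_card A).+1) : dom A None, w) => /=.
by rewrite hw inordK ?ltn_mod // addnC mulnC -divn_eq.
Qed.

Lemma def_blk_eq C ss (x y : cblk C ss) : var_block x -> var_block y ->
  definable (C := C) (fun A e => x A e == y A e).
Proof.
elim: ss x y => [|s ss IH] x y bx bY.
  by apply: def_ext (def_const C true) => A e _; case: (x A e); case: (y A e).
have := def_and (def_eq1 (blk_head bx) (blk_head bY)) (IH _ _ (blk_tail bx) (blk_tail bY)).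
by apply: def_ext => A e _; rewrite -pair_eqE.
Qed.

(** Only a successor relation is given, so 0 is recognized as the numeral without predecessor;
    dually, [def_max1] recognizes b - 1 as the numeral without successor. *)
Lemma def_zero1 C (x : cblk C [:: None]) : var_block x ->
  definable (C := C) (fun A e => ((x A e).1 : 'I_(universe_card A).+1) == 0 :> nat).
Proof.
move=> bx.
have := def_not (def_ex (def_succ1 (@blk_hd _ C [:: None]) (blk_mor (mor_tl _ _) bx))).
apply: def_ext => A e _ /=; rewrite negb_exists; case: (x A e) => -[[|a] ha] [] /=.
  by apply/forallP => -[].
apply/negbTE/forallPn.
by exists ((Ordinal (ltnW ha) : 'I_(universe_card A).+1) : dom A None, tt); rewrite /= eqxx.
Qed.

Lemma def_max1 C (x : cblk C [:: None]) : var_block x ->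
  definable (C := C) (fun A e => ((x A e).1 : 'I_(universe_card A).+1).+1 == base A).
Proof.
move=> bx.
have := def_not (def_ex (def_succ1 (blk_mor (mor_tl _ _) bx) (@blk_hd _ C [:: None]))).
apply: def_ext => A e _ /=; rewrite negb_exists; case: (x A e) => -[a ha] [] /=.
apply/forallP/eqP => [h|ea [[c hc] []] /=]; last first.
  by apply/eqP => ec; move: hc; rewrite ec ea ltnn.
apply/eqP; rewrite eqn_leq ha leqNgt; apply/negP => hb.
by have := h ((Ordinal hb : 'I_(universe_card A).+1) : dom A None, tt); rewrite /= eqxx.
Qed.

Lemma def_dec_zero C d (x : cblk C (nseq d None)) : var_block x ->
  definable (C := C) (fun A e => dec A (x A e) == 0).
Proof.
elim: d x => [|d IH] x bx; first exact: def_ext (def_const C true).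
have := def_and (def_zero1 (blk_head bx)) (IH _ (blk_tail bx)).
by apply: def_ext => A e _ /=; rewrite addn_eq0 muln_eq0.
Qed.

(** Odometer rule: either the low digit advances and the tails agree, or it passes from b - 1 to 0
    and the carry advances the tail. Wrapping around at b^d makes the rule hold without
    exception. *)
Lemma def_dec_succ C d (x y : cblk C (nseq d None)) : var_block x -> var_block y ->
  definable (C := C) (fun A e => dec A (y A e) == (dec A (x A e)).+1 %% base A ^ d).
Proof.
elim: d x y => [|d IH] x y bx bY; first exact: def_ext (def_const C true).
have := def_or (def_and (def_succ1 (blk_head bx) (blk_head bY)) (def_blk_eq (blk_tail bx) (blk_tail bY)))
  (def_and (def_max1 (blk_head bx)) (def_and (def_zero1 (blk_head bY)) (IH _ _ (blk_tail bx) (blk_tail bY)))).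
apply: def_ext => A e _ /=; case: (x A e) (y A e) => [a u] [c w] /=.
rewrite -(inj_eq (@dec_inj A d)).
have := digit_lt a; have := digit_lt c; have := dec_lt u; have := dec_lt w; rewrite expnS.
move: (nat_of_ord _) (nat_of_ord _) (dec A u) (dec A w) => a' c' U W.
have b0 : 0 < base A by [].
move: (base A) b0 (base A ^ d) => b b0 B hW hU hc ha.
have cmp p q P Q : p < b -> q < b -> (p + b * P == q + b * Q) = (p == q) && (P == Q).
  move=> hp hq; apply/eqP/andP => [h|[/eqP-> /eqP->] //].
  have := congr1 (modn^~ b) h; have := congr1 (divn^~ b) h.
  rewrite ![b * _]mulnC ![_ + _ * b]addnC !modnMDl !divnMDl // !(modn_small, divn_small) //.
  by rewrite !addn0 => -> ->.
have [ea|na] := eqVneq a'.+1 b.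
  rewrite [c' == _](_ : _ = false) /=; last by rewrite -ea in hc *; lia.
  rewrite -addSn ea -mulnS -muln_modr -[b * (_ %% _)]add0n.
  by rewrite cmp.
have ha' : a'.+1 < b by rewrite ltn_neqAle na.
rewrite /= orbF -addSn modn_small ?cmp ?[W == U]eq_sym //.
apply: (@leq_trans (b + b * U)); first by rewrite ltn_add2r.
by rewrite -mulnS leq_mul2l hU orbT.
Qed.

(** Two digits would not do: twice the exponent in the size bound [fl_diag_lt] has the term 4n^2
    with n = |I|, which outgrows b^2 for large n and fixed k, whereas b^3 always exceeds it. *)
Definition num : seq (xsort V) := nseq 3 None.
Definition nbound A := base A ^ 3.
Definition numval A (w : stuple (dom A) num) : nat := dec A w.
Arguments numval : simpl never.

Lemma numval_inj A : injective (@numval A).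
Proof. exact: (@dec_inj A 3). Qed.

Lemma numval_lt A w : @numval A w < nbound A.
Proof. exact: dec_lt. Qed.

Lemma numval_surj A n : n < nbound A -> exists w, @numval A w = n.
Proof. exact: dec_surj. Qed.

(** Triples are not values of a single term, so a numerical function is given by its graph. The
    bound ensures that each value has a representing triple, which [def_let] needs in order to
    quantify over it. *)
Definition definable_num C (f : cfun C) :=
  (forall A (e : cE C A), cok e -> f A e < nbound A) /\
  definable (C := vars_ctx num C) (fun A e => numval e.1 == f A e.2).

Lemma num_ext C (f g : cfun C) :
  (forall A (e : cE C A), cok e -> f A e = g A e) -> definable_num f -> definable_num g.
Proof.
move=> fg [hf df]; split=> [A e ok|]; first by rewrite -fg // hf.
by apply: def_ext df => A e ok; rewrite fg.
Qed.

Lemma mor_lift C' C (m : cmap C' C) ss : ctx_mor m ->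
  ctx_mor (C' := vars_ctx ss C') (C := vars_ctx ss C) (fun A e => (e.1, m A e.2)).
Proof. by move=> hm; apply: mor_cons (blk_hd _ _); apply: mor_comp hm (mor_tl _ _). Qed.

Lemma num_mor C' C (m : cmap C' C) (f : cfun C) :
  ctx_mor m -> definable_num f -> definable_num (C := C') (fun A e => f A (m A e)).
Proof.
move=> hm [hf df]; split=> [A e ok|].
  by apply: hf; have [? [? h]] := hm; have [] := h A e ok.
exact: def_mor (mor_lift _ hm) df.
Qed.

Lemma num_blk C (x : cblk C num) : var_block x -> definable_num (C := C) (fun A e => numval (x A e)).
Proof.
move=> bx; split=> [A e _|]; first exact: numval_lt.
have := def_blk_eq (blk_hd C num) (blk_mor (mor_tl _ _) bx).
by apply: def_ext => A e _; rewrite (inj_eq (@numval_inj A)).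
Qed.

Lemma def_let C (f : cfun C) (Q : forall A, nat -> cE C A -> bool) :
  definable_num f -> definable (C := vars_ctx num C) (fun A e => Q A (numval e.1) e.2) ->
  definable (C := C) (fun A e => Q A (f A e) e).
Proof.
move=> [hf df] dQ; apply: def_ext (def_ex (def_and df dQ)) => A e ok /=.
apply/existsP/idP => [[w /andP[/eqP->]] //|h].
by have [w hw] := numval_surj (hf A e ok); exists w; rewrite hw eqxx.
Qed.

Lemma num_let C (f : cfun C) (g : forall A, nat -> cE C A -> nat) :
  definable_num f -> definable_num (C := vars_ctx num C) (fun A e => g A (numval e.1) e.2) ->
  definable_num (C := C) (fun A e => g A (f A e) e).
Proof.
move=> nf [hg dg]; split=> [A e ok|].
  have [w <-] := numval_surj (nf.1 A e ok); exact: (hg A (w, e)).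
apply: (def_let (C := vars_ctx num C) (f := fun A e => f A e.2)
  (Q := fun A n e => numval e.1 == g A n e.2)).
  exact: num_mor (mor_tl _ _) nf.
(* Exchange of the value of [g] with the value bound by the let. *)
have hm : ctx_mor (C' := vars_ctx num (vars_ctx num C)) (C := vars_ctx num (vars_ctx num C))
   (fun A e => (e.2.1, (e.1, e.2.2))).
  by apply: mor_cons (blk_mor (mor_tl _ _) (blk_hd _ _)); apply: mor_lift (mor_tl _ _).
exact: def_mor hm dg.
Qed.

Lemma def_eqn C (f g : cfun C) :
  definable_num f -> definable_num g -> definable (C := C) (fun A e => f A e == g A e).
Proof. by move=> nf [_ dg]; apply: (def_let (Q := fun A n e => n == g A e)). Qed.

Lemma num_if C (P : cpred C) (f g : cfun C) : definable P -> definable_num f -> definable_num g ->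
  definable_num (C := C) (fun A e => if P A e then f A e else g A e).
Proof.
move=> dP [hf df] [hg dg]; split=> [A e ok|]; first by case: ifP; rewrite ?hf ?hg.
have dP' := def_mor (mor_tl C num) dP.
have := def_or (def_and dP' df) (def_and (def_not dP') dg).
by apply: def_ext => A e ok; case: (P A e.2); rewrite /= ?orbF.
Qed.

Lemma nbound_gt0 A : 0 < nbound A.
Proof. by rewrite expn_gt0. Qed.

Lemma num_zero C : definable_num (C := C) (fun A e => 0).
Proof.
by split=> [A e _|]; [apply: nbound_gt0 | apply: def_dec_zero (blk_hd _ _)].
Qed.

Lemma num_succ C (f : cfun C) : definable_num f -> definable_num (C := C) (fun A e => (f A e).+1 %% nbound A).
Proof.
move=> nf; apply: (num_let (g := fun A n e => n.+1 %% nbound A)) nf _.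
split=> [A e _|]; first by rewrite ltn_mod nbound_gt0.
exact: def_dec_succ (blk_mor (mor_tl _ _) (blk_hd _ _)) (blk_hd _ _).
Qed.

Lemma num_card C s (P : cpred (vars_ctx [:: Some s] C)) : definable P ->
  definable_num (C := C) (fun A e =>
    #|[set a : carrier A s | P A (((a, tt) : stuple (dom A) [:: Some s]), e)]|).
Proof.
move=> dP; split=> [A e ok|].
  apply: leq_ltn_trans (count_le _) _; rewrite /nbound /base.
  by rewrite -[X in X < _]expn1 (leq_trans (_ : _ < (universe_card A).+1 ^ 1)) ?leq_pexp2l.
have hm := mor_lift [:: Some s] (mor_tl C num).
(* The count is at most |A| < b, so it fits in the low digit and the two other digits are 0. *)
have := def_and (def_card_eq (def_mor hm dP) (blk_head (blk_hd C num)))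
  (def_dec_zero (d := 2) (blk_tail (blk_hd C num))).
apply: def_ext => A [w e] ok.
rewrite -[(w, e).1]/w -[(w, e).2]/e.
rewrite [numval w](_ : _ = (w.1 : 'I_(universe_card A).+1) + base A * @dec A 2 w.2) //.
set c := #|_|; have hc : c < base A by rewrite ltnS; apply: count_le.
have := digit_lt w.1; have b0 : 0 < base A by [].
move: (nat_of_ord _) (@dec A 2 _) (base A) b0 hc => a' w' b b0 hc ha.
apply/andP/eqP => [[/eqP-> /eqP->]|]; first by rewrite muln0 addn0.
case: w' => [|w']; rewrite ?muln0 ?addn0 ?mulnS => e1; first by rewrite e1 eqxx.
by move: hc; rewrite -e1 addnCA -[X in _ < X]addn0 ltn_add2l.
Qed.

End Numbers.
Arguments dec {V} A {d} w.
Arguments num {V}.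
Arguments numval {V A} w : simpl never.

(** * Recursion through inflationary fixpoints *)
Section Recursion.
Variable V : vocabulary.
Implicit Type A : structure V.
Implicit Type C : ctx V.

Definition graph_sorts (ss : seq (xsort V)) := num ++ (ss ++ num).

Definition entry A ss (t : stuple (dom A) num) (z : stuple (dom A) ss) (y : stuple (dom A) num) :
  stuple (dom A) (graph_sorts ss) := stuple_cat t (stuple_cat z y).

(** The default 0 only makes the function total; it does not occur where [graph_at] holds. *)
Definition apply_graph A ss (R : {set stuple (dom A) (graph_sorts ss)}) t (z : stuple (dom A) ss) : nat :=
  if [pick y | entry t z y \in R] is Some y then numval y else 0.

Definition graph_at A ss (R : {set stuple (dom A) (graph_sorts ss)}) (t : stuple (dom A) num) :=
  forall z : stuple (dom A) ss, exists y, forall y', (entry t z y' \in R) = (y' == y).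

Lemma apply_graphP A ss (R : {set stuple (dom A) (graph_sorts ss)}) t z y :
  graph_at R t -> (entry t z y \in R) = (numval y == apply_graph R t z).
Proof.
move=> /(_ z)[y0 h]; rewrite h /apply_graph; case: pickP => [y1|/(_ y0)]; last by rewrite h eqxx.
by rewrite h => /eqP->; rewrite (inj_eq (@numval_inj _ A)).
Qed.

Definition time_ctx ss C : ctx V := vars_ctx num (rel_ctx (graph_sorts ss) C).

(* The relation variable is read as the function whose graph is its section at
   the time given by the first element variables. *)
Definition fun_ctx ss C : ctx V :=
  restrict_ctx (C := time_ctx ss C) (fun A e => cok e.2.2 /\ graph_at e.2.1 e.1).

Lemma mor_restrict C ok : (forall A (e : cE C A), ok A e -> cok e) ->
  ctx_mor (C' := restrict_ctx (C := C) ok) (C := C) (fun A e => e).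
Proof. by move=> h; exists (fun _ x => x), (fun _ x => x) => A e /h. Qed.

Lemma mor_fun_ctx ss C : ctx_mor (C' := fun_ctx ss C) (C := time_ctx ss C) (fun A e => e).
Proof. by apply: mor_restrict => A e []. Qed.

Lemma num_apply_graph ss C :
  definable_num (C := vars_ctx ss (fun_ctx ss C)) (fun A e => apply_graph e.2.2.1 e.2.1 e.1).
Proof.
split=> [A e _|]; first by rewrite /apply_graph; case: pickP => [*|_]; rewrite ?numval_lt ?nbound_gt0.
have hm : ctx_mor (C' := vars_ctx num (vars_ctx ss (fun_ctx ss C))) (C := time_ctx ss C) (fun A e => e.2.2).
  exact: mor_comp (mor_fun_ctx _ _) (mor_comp (mor_tl _ _) (mor_tl _ _)).
have bt := blk_mor hm (blk_hd _ _).
have bz := blk_mor (mor_tl _ num) (blk_hd (fun_ctx ss C) ss).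
have bY := blk_hd (vars_ctx ss (fun_ctx ss C)) num.
have := def_member (mor_comp (mor_tl _ _) hm) (blk_cat bt (blk_cat bz bY)).
by apply: def_ext => A [y [z [t [R e]]]] [_ g] /=; rewrite -/(entry t z y) apply_graphP.
Qed.

(* The fixpoint relation collects the triples (t, z, F t z), one value of [t] per
   stage; a successor step is taken only from times already in the relation,
   where the sections are complete graphs. *)
Lemma num_rec_graph C ss (F : forall A, cE C A -> nat -> stuple (dom A) ss -> nat)
    (H : forall A, cE C A -> nat -> (stuple (dom A) ss -> nat) -> stuple (dom A) ss -> nat) :
  (forall A (e : cE C A) t z, cok e -> t < nbound A -> F A e t z < nbound A) ->
  (forall A (e : cE C A) t u z, cok e -> t.+1 < nbound A ->
     (forall z, u z = F A e t z) -> H A e t u z = F A e t.+1 z) ->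
  definable_num (C := vars_ctx ss C) (fun A e => F A e.2 0 e.1) ->
  definable_num (C := vars_ctx ss (fun_ctx ss C)) (fun A e =>
    H A e.2.2.2 (numval e.2.1) (apply_graph e.2.2.1 e.2.1) e.1) ->
  definable (C := vars_ctx num (vars_ctx ss (vars_ctx num C)))
    (fun A e => numval e.1 == F A e.2.2.2 (numval e.2.2.1) e.2.1).
Proof.
move=> Flt FS [_ d0] [_ dS].
pose CT : ctx V := vars_ctx num (vars_ctx ss (time_ctx ss C)).
(* The fixpoint operator evaluates its body at arbitrary relations, while the step is known to be
   correct only at complete graphs. [P'] is defined everywhere and agrees with the step there. *)
have [P' P'E dP'] := @def_relax _ CT
  (fun A e => cok e.2.2.2.2 /\ graph_at e.2.2.2.1 e.2.2.1) _ dS.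
pose rs := graph_sorts ss.
pose tm A (w : stuple (dom A) rs) : stuple (dom A) num := stuple_hd w.
pose zz A (w : stuple (dom A) rs) : stuple (dom A) ss := stuple_hd (stuple_tl w).
pose yy A (w : stuple (dom A) rs) : stuple (dom A) num := stuple_tl (stuple_tl w).
have wE A (w : stuple (dom A) rs) : entry (tm A w) (zz A w) (yy A w) = w.
  by rewrite /entry !stuple_cat_hdtl.
have tmE A t z y : tm A (entry t z y) = t by apply: stuple_hdK.
have zzE A t z y : zz A (entry t z y) = z by rewrite /zz /entry stuple_tlK stuple_hdK.
have yyE A t z y : yy A (entry t z y) = y by rewrite /yy /entry !stuple_tlK.
pose CR : ctx V := vars_ctx rs (rel_ctx rs C).
(* Successor on triples wraps around at b^3; requiring a nonzero time in the second clause excludes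
   the step from b^3 - 1 back to 0. *)
pose P : cpred CR := fun A e =>
  ((numval (tm A e.1) == 0) && (numval (yy A e.1) == F A e.2.2 0 (zz A e.1))) ||
  (~~ (numval (tm A e.1) == 0) && [exists t' : stuple (dom A) num,
    (numval (tm A e.1) == (numval t').+1 %% nbound A) &&
    ([exists q : stuple (dom A) (ss ++ num), (stuple_cat t' q : stuple (dom A) rs) \in e.2.1] &&
    P' A (yy A e.1, (zz A e.1, (t', e.2))))]).
have dP : definable P.
  have bt : var_block (C := CR) (fun A e => tm A e.1) := blk_take (blk_hd (rel_ctx rs C) rs).
  have bzy := blk_drop (blk_hd (rel_ctx rs C) rs).
  have bz : var_block (C := CR) (fun A e => zz A e.1) := blk_take bzy.
  have bY : var_block (C := CR) (fun A e => yy A e.1) := blk_drop bzy.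
  have m2 : ctx_mor (C' := CR) (C := C) (fun A e => e.2.2) := mor_comp (mor_rtl _ _) (mor_tl _ _).
  have m1 : ctx_mor (C' := vars_ctx num CR) (C := time_ctx ss C) (fun A e => (e.1, e.2.2)).
    exact: mor_lift (mor_tl _ _).
  have m3 : ctx_mor (C' := vars_ctx (ss ++ num) (vars_ctx num CR)) (C := rel_ctx rs C) (fun A e => e.2.2.2).
    exact: mor_comp (mor_tl _ _) (mor_comp (mor_tl _ _) (mor_tl _ _)).
  have dz := def_dec_zero (d := 3) bt.
  have d1 := def_mor (mor_cons (mor_cons m2 bz) bY) d0.
  have d2 := def_dec_succ (d := 3) (blk_hd CR num) (blk_mor (mor_tl _ _) bt).
  have d3 := def_ex (def_member m3 (blk_cat (blk_mor (mor_tl _ _) (blk_hd _ _)) (blk_hd _ _))).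
  have d4 := def_mor (mor_cons (mor_cons m1 (blk_mor (mor_tl _ _) bz)) (blk_mor (mor_tl _ _) bY)) dP'.
  exact: def_or (def_and dz d1) (def_and (def_not dz) (def_ex (def_and d2 (def_and d3 d4)))).
have key A (e : cE C A) (w : stuple (dom A) rs) : cok e ->
  (w \in ifp (fun Y => [set w | P A (w, (Y, e))])) =
  (numval (yy A w) == F A e (numval (tm A w)) (zz A w)).
  move=> ok; set G := fun Y => _.
  (* Stage n is exactly the graph at times below n: the next stage adds time n, and recomputing an
     earlier time reproduces the entries it already has. *)
  have st n : ifp_stage G n = [set w | (numval (tm A w) < n) &&
      (numval (yy A w) == F A e (numval (tm A w)) (zz A w))].
    elim: n => [|n IH]; first by apply/setP => v; rewrite !inE.
    apply/setP => v; rewrite /ifp_stage iterS -/(ifp_stage G n) IH.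
    set Yn := finset _; rewrite /G !inE /P /=.
    have YnE t z y : (entry t z y \in Yn) = (numval t < n) && (numval y == F A e (numval t) z).
      by rewrite inE tmE zzE yyE.
    have := numval_lt (tm A v).
    case et: (numval (tm A v)) => [|s] hs /=.
      by rewrite orbF; case: (0 < n) => /=; rewrite ?orbb ?orFb.
    have [t' ht'] := numval_surj (ltnW hs).
    have hP : s < n -> P' A (yy A v, (zz A v, (t', (Yn, e)))) =
        (numval (yy A v) == F A e s.+1 (zz A v)).
      move=> sn; have gr : graph_at Yn t'.
        move=> z; have [y hy] := numval_surj (Flt A e s z ok (ltnW hs)); exists y => y'.
        by rewrite YnE ht' sn -hy (inj_eq (@numval_inj _ A)).
      rewrite P'E /=; last by split.
      rewrite ht' (FS A e s) // => z; apply/eqP; rewrite eq_sym.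
      have [y hy] := numval_surj (Flt A e s z ok (ltnW hs)).
      by rewrite -hy -apply_graphP // YnE ht' sn hy eqxx.
    rewrite (_ : [exists t0, _] = (s < n) && (numval (yy A v) == F A e s.+1 (zz A v))).
      by rewrite ltnS -andb_orl; congr (_ && _); apply/orP/idP => [[/ltnW|]//|->]; right.
    apply/existsP/andP => [[t0 /and3P[/eqP e0 /existsP[q hq] hP']]|[sn hF]].
      have et0 : t0 = t'.
        apply: (@numval_inj _ A); rewrite ht'; move: e0.
        have := numval_lt t0; rewrite leq_eqVlt => /orP[/eqP->|h]; first by rewrite modnn.
        by rewrite modn_small // => -[].
      have sn : s < n.
        by move: hq; rewrite et0 -(stuple_cat_hdtl q) -/(entry _ _ _) YnE ht' => /andP[].
      by rewrite sn -hP // -et0.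
    exists t'; rewrite ht' modn_small // eqxx hP // hF andbT /=.
    have [y hy] := numval_surj (Flt A e s (zz A v) ok (ltnW hs)).
    by apply/existsP; exists (stuple_cat (zz A v) y); rewrite -/(entry _ _ _) YnE ht' sn hy /=.
  apply/ifpP/idP => [[n]|h]; first by rewrite st inE => /andP[].
  (* All times are below b^3, so that many stages contain the whole graph. *)
  by exists (nbound A); rewrite st inE numval_lt.
have dI := def_ifp dP.
have m : ctx_mor (C' := vars_ctx num (vars_ctx ss (vars_ctx num C))) (C := vars_ctx rs C)
   (fun A e => (entry e.2.2.1 e.2.1 e.1, e.2.2.2)).
  have mm := mor_tl (vars_ctx ss (vars_ctx num C)) num.
  have mt := mor_comp (mor_tl (vars_ctx num C) ss) mm.
  apply: mor_cons (mor_comp (mor_tl _ _) mt) _.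
  exact: blk_cat (blk_mor mt (blk_hd _ _)) (blk_cat (blk_mor mm (blk_hd _ _)) (blk_hd _ _)).
apply: def_ext (def_mor m dI) => A e ok.
by rewrite (key A e.2.2.2) //= tmE zzE yyE.
Qed.

(** The form used below: the step is checked in an arbitrary context, with the previous value [u] an
    abstract definable function, so neither the fixpoint relation nor the restricted environments
    appear. *)
Lemma num_rec C ss (F : forall A, cE C A -> nat -> stuple (dom A) ss -> nat)
    (H : forall A, cE C A -> nat -> (stuple (dom A) ss -> nat) -> stuple (dom A) ss -> nat) :
  (forall A (e : cE C A) t z, cok e -> t < nbound A -> F A e t z < nbound A) ->
  (forall A (e : cE C A) t u z, cok e -> t.+1 < nbound A ->
     (forall z, u z = F A e t z) -> H A e t u z = F A e t.+1 z) ->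
  definable_num (C := vars_ctx ss C) (fun A e => F A e.2 0 e.1) ->
  (forall C1 (m : cmap C1 C) (t : cfun C1)
      (u : forall A, cE C1 A -> stuple (dom A) ss -> nat) (z : cblk C1 ss),
    ctx_mor m -> definable_num t ->
    definable_num (C := vars_ctx ss C1) (fun A e => u A e.2 e.1) -> var_block z ->
    definable_num (C := C1) (fun A e => H A (m A e) (t A e) (u A e) (z A e))) ->
  forall (T : cfun C), definable_num T ->
    definable_num (C := vars_ctx ss C) (fun A e => F A e.2 (T A e.2) e.1).
Proof.
move=> Flt FS d0 dS T dT.
have mf : ctx_mor (C' := vars_ctx ss (fun_ctx ss C)) (C := time_ctx ss C) (fun A e => e.2).
  exact: mor_comp (mor_fun_ctx _ _) (mor_tl _ _).
have ds : definable_num (C := vars_ctx ss (fun_ctx ss C)) (fun A e =>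
    H A e.2.2.2 (numval e.2.1) (apply_graph e.2.2.1 e.2.1) e.1).
  apply: (dS (vars_ctx ss (fun_ctx ss C)) (fun A e => e.2.2.2) (fun A e => numval e.2.1)
     (fun A e => apply_graph e.2.2.1 e.2.1) (fun A e => e.1)) (blk_hd _ _).
  - exact: mor_comp (mor_rtl _ _) (mor_comp (mor_tl _ _) mf).
  - exact: num_blk (blk_mor mf (blk_hd _ _)).
  - exact: num_mor (mor_lift _ (mor_tl _ _)) (num_apply_graph ss C).
have dG := num_rec_graph Flt FS d0 ds.
split=> [A e ok|]; first by apply: Flt; rewrite ?dT.1.
apply: (def_let (C := vars_ctx num (vars_ctx ss C)) (f := fun A e => T A e.2.2)
  (Q := fun A n e => numval e.1 == F A e.2.2 n e.2.1)).
  exact: num_mor (mor_comp (mor_tl _ _) (mor_tl _ _)) dT.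
have m : ctx_mor (C' := vars_ctx num (vars_ctx num (vars_ctx ss C)))
    (C := vars_ctx num (vars_ctx ss (vars_ctx num C)))
   (fun A e => (e.2.1, (e.2.2.1, (e.1, e.2.2.2)))).
  have m1 := mor_tl (vars_ctx num (vars_ctx ss C)) num.
  have m2 := mor_comp (mor_tl (vars_ctx ss C) num) m1.
  exact: mor_cons (mor_cons (mor_cons (mor_comp (mor_tl _ _) m2) (blk_hd _ _))
    (blk_mor m2 (blk_hd _ _))) (blk_mor m1 (blk_hd _ _)).
exact: def_mor m dG.
Qed.
End Recursion.

(** * Modular arithmetic *)
Section Arithmetic.
Variable V : vocabulary.
Implicit Type A : structure V.
Implicit Type C : ctx V.

Lemma num_subst C' C ss (f : cfun (vars_ctx ss C)) (m : cmap C' C) (x : cblk C' ss) :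
  definable_num f -> ctx_mor m -> var_block x -> definable_num (C := C') (fun A e => f A (x A e, m A e)).
Proof. by move=> df hm bx; apply: num_mor (mor_cons hm bx) df. Qed.

Lemma num_iter C (F : forall A, cE C A -> nat -> nat) (h : forall A, cE C A -> nat -> nat -> nat) :
  (forall A (e : cE C A) t, cok e -> t < nbound A -> F A e t < nbound A) ->
  (forall A (e : cE C A) t, cok e -> t.+1 < nbound A -> h A e t (F A e t) = F A e t.+1) ->
  definable_num (C := C) (fun A e => F A e 0) ->
  (forall C1 (m : cmap C1 C) (t u : cfun C1), ctx_mor m -> definable_num t -> definable_num u ->
    definable_num (C := C1) (fun A e => h A (m A e) (t A e) (u A e))) ->
  forall (T : cfun C), definable_num T -> definable_num (C := C) (fun A e => F A e (T A e)).
Proof.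
move=> Flt FS d0 dS T dT.
have d : definable_num (C := vars_ctx [::] C) (fun A e => F A e.2 (T A e.2)).
  apply: (num_rec (F := fun A e t (_ : stuple (dom A) [::]) => F A e t)
                  (H := fun A e t u z => h A e t (u z))) dT.
  - by move=> A e t _; apply: Flt.
  - by move=> A e t u z ok ht ->; apply: FS.
  - exact: num_mor (mor_tl _ _) d0.
  - by move=> C1 m t u z hm dt du bz; apply: dS => //; apply: num_subst du (mor_id _) bz.
exact: num_subst d (mor_id _) (blk_nil _).
Qed.

(* A modulus [m.+1] is always represented by [m], which keeps it positive. *)
Definition succ_upto A m u := if u == m then 0 else u.+1 %% nbound A.

Lemma succ_uptoE A m x : m < nbound A -> succ_upto A m (x %% m.+1) = x.+1 %% m.+1.
Proof.
move=> hm; rewrite /succ_upto -[in RHS]addn1 -modnDml addn1.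
have : x %% m.+1 < m.+1 by rewrite ltn_mod.
case: eqP => [->|ne hx]; first by rewrite modnn.
have lt : (x %% m.+1).+1 < m.+1 by rewrite ltn_neqAle hx andbT; apply/eqP => -[].
by rewrite (modn_small lt) (modn_small (leq_trans lt hm)).
Qed.

Lemma num_succ_upto C (f m : cfun C) : definable_num f -> definable_num m ->
  definable_num (C := C) (fun A e => succ_upto A (m A e) (f A e)).
Proof. by move=> df dm; apply: num_if (def_eqn df dm) (num_zero _) (num_succ df). Qed.

Lemma num_modS_lt C (m f : cfun C) : definable_num m ->
  forall A (e : cE C A), cok e -> f A e %% (m A e).+1 < nbound A.
Proof. by move=> [hm _] A e ok; apply: leq_trans (hm A e ok); rewrite ltn_mod. Qed.

(** Reduction is counting up to [f] on a cycle of length [m.+1]. In the same way addition iterates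
    the successor, multiplication iterates addition and [num_exp2] iterates doubling. *)
Lemma num_modS C (f m : cfun C) : definable_num f -> definable_num m ->
  definable_num (C := C) (fun A e => f A e %% (m A e).+1).
Proof.
move=> df dm.
apply: (num_iter (F := fun A e t => t %% (m A e).+1)
                 (h := fun A e t u => succ_upto A (m A e) u)) df.
- by move=> A e t ok _; apply: (num_modS_lt (fun _ _ => t) dm).
- by move=> A e t ok _; rewrite succ_uptoE // dm.1.
- by apply: num_ext (num_zero _) => A e _; rewrite mod0n.
- by move=> C1 k t u hk dt du; apply: num_succ_upto du (num_mor hk dm).
Qed.

Lemma num_add C (f g m : cfun C) : definable_num f -> definable_num g -> definable_num m ->
  definable_num (C := C) (fun A e => (f A e + g A e) %% (m A e).+1).
Proof.
move=> df dg dm.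
apply: (num_iter (F := fun A e t => (f A e + t) %% (m A e).+1)
                 (h := fun A e t u => succ_upto A (m A e) u)) dg.
- by move=> A e t ok _; apply: (num_modS_lt (fun A e => f A e + t) dm).
- by move=> A e t ok _; rewrite succ_uptoE ?dm.1 // addnS.
- by apply: num_ext (num_modS df dm) => A e _; rewrite addn0.
- by move=> C1 k t u hk dt du; apply: num_succ_upto du (num_mor hk dm).
Qed.

Lemma num_mul C (f g m : cfun C) : definable_num f -> definable_num g -> definable_num m ->
  definable_num (C := C) (fun A e => (f A e * g A e) %% (m A e).+1).
Proof.
move=> df dg dm.
apply: (num_iter (F := fun A e t => (f A e * t) %% (m A e).+1)
                 (h := fun A e t u => (u + f A e) %% (m A e).+1)) dg.
- by move=> A e t ok _; apply: (num_modS_lt (fun A e => f A e * t) dm).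
- by move=> A e t ok _; rewrite modnDml mulnS addnC.
- by apply: num_ext (num_zero _) => A e _; rewrite muln0 mod0n.
- by move=> C1 k t u hk dt du; apply: num_add du (num_mor hk df) (num_mor hk dm).
Qed.

Lemma num_exp2 C (f m : cfun C) : definable_num f -> definable_num m ->
  definable_num (C := C) (fun A e => 2 ^ f A e %% (m A e).+1).
Proof.
move=> df dm.
apply: (num_iter (F := fun A e t => 2 ^ t %% (m A e).+1)
                 (h := fun A e t u => (u + u) %% (m A e).+1)) df.
- by move=> A e t ok _; apply: (num_modS_lt (fun A e => 2 ^ t) dm).
- by move=> A e t ok _; rewrite modnDm addnn -mul2n expnS.
- apply: num_ext (num_succ_upto (num_zero _) dm) => A e ok.
  by rewrite -(mod0n (m A e).+1) succ_uptoE // dm.1.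
- by move=> C1 k t u hk dt du; exact: (num_add du du (num_mor hk dm)).
Qed.

Lemma sum_by_value (T : finType) (h : T -> nat) m :
  (\sum_(i < m.+1) i * #|[set a | h a %% m.+1 == i]|) %% m.+1 = (\sum_a h a) %% m.+1.
Proof.
rewrite -[RHS]modn_summ; congr (_ %% _).
rewrite [RHS](partition_big (fun a => inord (h a %% m.+1) : 'I_m.+1) xpredT) //=.
apply: eq_bigr => i _; rewrite mulnC -sum_nat_const; apply: eq_big => [a|a].
  by rewrite inE -val_eqE /= inordK // ltn_mod.
by rewrite inE => /eqP.
Qed.

Lemma num_sum C s (h : cfun (vars_ctx [:: Some s] C)) (m : cfun C) : definable_num h -> definable_num m ->
  definable_num (C := C) (fun A e =>
    (\sum_(a : carrier A s) h A ((a, tt) : stuple (dom A) [:: Some s], e)) %% (m A e).+1).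
Proof.
move=> dh dm.
pose c A (e : cE C A) t := #|[set a : carrier A s |
  h A ((a, tt) : stuple (dom A) [:: Some s], e) %% (m A e).+1 == t]|.
pose F A (e : cE C A) t := (\sum_(i < t.+1) i * c A e i) %% (m A e).+1.
suff d : definable_num (C := C) (fun A e => F A e (m A e)).
  by apply: num_ext d => A e _; rewrite -sum_by_value.
(* The step must be definable for every definable [t], so its successor is taken modulo b^3; at the
   times that the recursion reaches, the reduction changes nothing. *)
apply: (num_iter (F := F) (h := fun A e t u =>
  (u + ((t.+1 %% nbound A) * c A e (t.+1 %% nbound A)) %% (m A e).+1) %% (m A e).+1)) (dm).
- by move=> A e t ok _; apply: leq_trans (dm.1 A e ok); rewrite ltn_mod.
- by move=> A e t ok lt; rewrite (modn_small lt) /F [in RHS]big_ord_recr /= modnDm.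
- by apply: num_ext (num_zero _) => A e _; rewrite /F big_ord_recr big_ord0 /= mul0n mod0n.
- move=> C1 k t u hk dt du; apply: num_add du _ (num_mor hk dm).
  apply: num_mul (num_succ dt) _ (num_mor hk dm).
  have dh' := num_mor (mor_lift [:: Some s] hk) dh.
  have dm' := num_mor (mor_comp hk (mor_tl _ [:: Some s])) dm.
  exact: num_card (def_eqn (num_modS dh' dm') (num_mor (mor_tl _ [:: Some s]) (num_succ dt))).
Qed.

End Arithmetic.

(** * The formula *)
Section MatrixFormula.
Implicit Type A : structure mxvoc.
Implicit Type C : ctx mxvoc.

Notation ix := (Some IndexSort : xsort mxvoc).
Notation idx A := (carrier A (IndexSort : vsort mxvoc)).
Notation bit A := (carrier A (BitSort : vsort mxvoc)).

Definition bitlt A (s t : bit A) : bool := @interp mxvoc A BitLt (s, (t, tt)).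
Definition bitof A (i j : idx A) (s : bit A) : bool := @interp mxvoc A BitOf (i, (j, (s, tt))).
Definition positive A (i j : idx A) : bool := @interp mxvoc A Positive (i, (j, tt)).

(** The bit sort carries only an order, so the exponent belonging to a bit is recovered as the
    number of bits below it. *)
Definition abs_residue A (i j : idx A) m :=
  (\sum_(s : bit A) if bitof i j s then 2 ^ #|[set t | bitlt t s]| %% m.+1 else 0) %% m.+1.

(* Modulo [m.+1], the factor [m] stands for -1. *)
Definition entry_residue A (i j : idx A) m :=
  if positive i j then abs_residue i j m else (m * abs_residue i j m) %% m.+1.

Lemma num_entry C (i j : cblk C [:: ix]) (m : cfun C) : var_block i -> var_block j -> definable_num m ->
  definable_num (C := C) (fun A e => entry_residue (A := A) (i A e).1 (j A e).1 (m A e)).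
Proof.
move=> bi bj dm.
have dabs : definable_num (C := C) (fun A e => abs_residue (A := A) (i A e).1 (j A e).1 (m A e)).
  pose bs : xsort mxvoc := Some BitSort.
  have mb := mor_tl C [:: bs]; have b1 := blk_hd C [:: bs].
  have mb2 := mor_tl (vars_ctx [:: bs] C) [:: bs]; have b2 := blk_hd (vars_ctx [:: bs] C) [:: bs].
  have dlt := @def_rel mxvoc _ BitLt _ (blk_cat b2 (blk_mor mb2 b1)).
  have dof := @def_rel mxvoc _ BitOf _ (blk_cat (blk_mor mb bi) (blk_cat (blk_mor mb bj) b1)).
  have dh := num_if dof (num_exp2 (num_card dlt) (num_mor mb dm)) (num_zero _).
  apply: num_ext (num_sum dh dm) => A e _; congr (_ %% _); apply: eq_bigr => s _ /=.
have dpos := @def_rel mxvoc _ Positive _ (blk_cat bi bj).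
apply: num_ext (num_if dpos dabs (num_mul dm dabs dm)) => A e _.
by rewrite /entry_residue /positive /=; case: (i A e) (j A e) => [a []] [b []].
Qed.

(* One step of Y_(t+1) = (t+1) M Y_t - tr(Y_t) M modulo [m.+1], with k = t+1. *)
Definition fl_step A m k (u : idx A -> idx A -> nat) (i j : idx A) :=
  ((k * ((\sum_(l : idx A) (entry_residue i l m * u l j) %% m.+1) %% m.+1)) %% m.+1 +
   (((m * ((\sum_(l : idx A) u l l) %% m.+1)) %% m.+1) * entry_residue i j m) %% m.+1) %% m.+1.

Fixpoint fl_residue A m t : idx A -> idx A -> nat :=
  if t is t'.+1 then fl_step m t (fl_residue m t') else fun i j => entry_residue i j m.

Lemma entry_residue_lt A (i j : idx A) m : entry_residue i j m < m.+1.
Proof. by rewrite /entry_residue /abs_residue; case: ifP; rewrite ltn_mod. Qed.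

Lemma fl_residue_lt A m t (i j : idx A) : fl_residue m t i j < m.+1.
Proof. by case: t => [|t]; rewrite ?entry_residue_lt ?ltn_mod. Qed.

Lemma num_fl C (i : cblk C [:: ix]) (m t : cfun C) : var_block i -> definable_num m -> definable_num t ->
  definable_num (C := C) (fun A e => fl_residue (A := A) (m A e) (t A e) (i A e).1 (i A e).1).
Proof.
move=> bi dm dt.
pose F A (e : cE C A) t (z : stuple (dom A) [:: ix; ix]) :=
  fl_residue (A := A) (m A e) t z.1 z.2.1.
(* Each step needs all entries of the previous matrix, so the recursion has the index pair as
   argument; the diagonal is taken only at the end. *)
suff d : definable_num (C := vars_ctx [:: ix; ix] C) (fun A e => F A e.2 (t A e.2) e.1).
  have := num_subst d (mor_id _) (blk_cat bi bi); exact: id.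
apply (@num_rec mxvoc C [:: ix; ix] F (fun A e t u z => @fl_step A (m A e) (t.+1 %% nbound A)
  (fun i j => u (i, (j, tt))) z.1 z.2.1)) => //.
- by move=> A e t0 z ok _; apply: leq_trans (dm.1 A e ok); apply: fl_residue_lt.
- move=> A e t0 u z ok lt hu; rewrite (modn_small lt) /F /= /fl_step /=.
  by congr ((_ * (_ %% _) %% _ + (_ * (_ %% _) %% _) * _ %% _) %% _); apply: eq_bigr => l _; rewrite hu.
- exact: num_entry (blk_head (blk_hd _ _)) (blk_head (blk_tail (blk_hd _ _))) (num_mor (mor_tl _ _) dm).
move=> C1 k t1 u z hk dt1 du bz.
have bi1 := blk_head bz; have bj1 := blk_head (blk_tail bz); have m1 := num_mor hk dm.
have mt := mor_tl C1 [:: ix]; have bl := blk_hd C1 [:: ix]; have m2 := num_mor mt m1.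
have dprod := num_mul (num_entry (blk_mor mt bi1) bl m2)
  (num_subst du mt (blk_cat bl (blk_mor mt bj1))) m2.
have dtr := num_sum (num_subst du mt (blk_cat bl bl)) m1.
have := num_add (num_mul (num_succ dt1) (num_sum dprod m1) m1)
  (num_mul (num_mul m1 dtr m1) (num_entry bi1 bj1 m1) m1) m1.
exact: id.
Qed.

(** A counting term yields n - 1 directly, as the number of indices other than [i]. The diagonal
    entries are all equal, so the quantifier over [i] matters only for empty [I], where the
    universal one agrees with the determinant being 1. *)
Definition nonsingular_test A := [forall i : idx A, [exists m : stuple (dom A) num,
  fl_residue (numval m) #|[set j | j != i]| i i != 0]].

Lemma nonsingular_test_definable :
  exists phi : sentence mxvoc, forall A, satisfies A phi = nonsingular_test A.
Proof.
have b1 := blk_hd (empty_ctx mxvoc) [:: ix].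
have bn := blk_mor (mor_tl _ num) b1.
have bj := blk_hd (vars_ctx num (vars_ctx [:: ix] (empty_ctx mxvoc))) [:: ix].
have dne := def_not (def_eq1 bj (blk_mor (mor_tl _ _) bn)).
have dF := num_fl bn (num_blk (blk_hd _ _)) (num_card dne).
have [phi h] := def_all (def_ex (def_not (def_eqn dF (num_zero _)))).
exists phi => A; rewrite /satisfies (h A tt I); apply/forallP/forallP => /= hx.
  by move=> i; have := hx (i, tt).
by case=> i []; have := hx i.
Qed.
End MatrixFormula.

Import Order.TTheory GRing.Theory Num.Theory.

(** * The Faddeev-LeVerrier recursion *)
Section FaddeevLeVerrier.
Local Open Scope ring_scope.
Variable R : comNzRingType.

Lemma deriv_prod_seq (I : eqType) (r : seq I) (F : I -> {poly R}) : uniq r ->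
  (\prod_(i <- r) F i)^`() = \sum_(i <- r) (F i)^`() * \prod_(j <- r | j != i) F j.
Proof.
elim: r => [|a r IH] /=; first by rewrite !big_nil derivC.
case/andP=> ar ur; rewrite !big_cons derivM IH // eqxx /=; congr (_ * _ + _).
  rewrite big_seq [RHS]big_seq_cond; apply: eq_bigl => j; case: (boolP (j \in r)) => //= jr.
  by rewrite (memPn ar).
rewrite mulr_sumr; apply: eq_big_seq => i ir.
rewrite big_cons [a == i]eq_sym (memPn ar) //=.
by rewrite mulrCA.
Qed.

(** The product rule in the Leibniz formula gives a sum of determinants, each with one row
    differentiated; each is then expanded along that row. *)
Lemma deriv_det n (B : 'M[{poly R}]_n) :
  (\det B)^`() = \sum_i \sum_j (B i j)^`() * cofactor B i j.
Proof.
pose Bi i := \matrix_(k, j) (if k == i then (B i j)^`() else B k j).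
transitivity (\sum_i \det (Bi i)); last first.
  apply: eq_bigr => i _; rewrite (expand_det_row _ i); apply: eq_bigr => j _.
  rewrite mxE eqxx; congr (_ * (_ * \det _)).
  by apply/matrixP => k l; rewrite !mxE [lift _ _ == _]eq_sym (negbTE (neq_lift _ _)).
rewrite /determinant exchange_big raddf_sum /=; apply: eq_bigr => s _.
rewrite -mulr_sumr -signr_odd; set b := odd _.
have -> (p : {poly R}) : ((-1) ^+ b * p)^`() = (-1) ^+ b * p^`().
  by case: b; rewrite ?expr0 ?mul1r // expr1 !mulN1r derivN.
congr (_ * _); rewrite deriv_prod_seq ?index_enum_uniq //; apply: eq_bigr => i _.
rewrite [RHS](bigD1 i) //= mxE eqxx; congr (_ * _); apply: eq_bigr => j ji.
by rewrite mxE (negbTE ji).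
Qed.

(** Jacobi's formula: X I - A has the identity as derivative, so only the diagonal cofactors
    survive. *)
Lemma deriv_char_poly n (A : 'M[R]_n) : (char_poly A)^`() = \tr (\adj (char_poly_mx A)).
Proof.
rewrite deriv_det; apply: eq_bigr => i _; rewrite (bigD1 i) //= big1 ?addr0 => [|j ji].
  by rewrite !mxE eqxx mulr1n derivB derivX derivC subr0 mul1r.
by rewrite !mxE eq_sym (negbTE ji) mulr0n derivB derivC derivC subr0 mul0r.
Qed.

(** The coefficient of X^s in adj(X I - A), read as a polynomial in X with matrix coefficients. *)
Definition adj_coef n (A : 'M[R]_n) s : 'M[R]_n :=
  \matrix_(i, j) ((\adj (char_poly_mx A)) i j)`_s.

(** Compare the coefficients of X^s in (X I - A) adj(X I - A) = char_poly(A) I. *)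
Lemma mul_adj_coef n (A : 'M[R]_n) s :
  A *m adj_coef A s = (if s is s'.+1 then adj_coef A s' else 0) - ((char_poly A)`_s)%:M.
Proof.
apply/matrixP => i j; have := mul_mx_adj (char_poly_mx A).
rewrite mulmxBl mul_scalar_mx => /(congr1 (fun B : 'M[{poly R}]_n => (B i j)`_s)).
rewrite !mxE coefB coefXM coefMn coef_sum -/(char_poly A) => e.
rewrite -e opprB addrCA [X in X + _](_ : _ = \sum_k A i k * adj_coef A s k j); last first.
  by apply: eq_bigr => k _; rewrite !mxE coefCM.
case: s {e} => [|s]; rewrite !mxE /= ?subr0 ?subrr ?addr0; apply: eq_bigr => k _; by rewrite mxE.
Qed.

Lemma adj_coef_eventually0 n (A : 'M[R]_n) : exists N, forall s, (N <= s)%N -> adj_coef A s = 0.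
Proof.
exists (\max_i \max_j size ((\adj (char_poly_mx A)) i j)) => s hs.
apply/matrixP => i j; rewrite [LHS]mxE [RHS]mxE nth_default //; apply: leq_trans hs.
by apply: (bigop.bigmax_sup i) => //; apply: (bigop.bigmax_sup j).
Qed.

(** No degree of a cofactor is computed. Starting from an index where the coefficient vanishes,
    [mul_adj_coef] carries the vanishing from s to s - 1 as long as s > n, because the
    characteristic polynomial has degree n. *)
Lemma adj_coef_ge n (A : 'M[R]_n) s : (n <= s)%N -> adj_coef A s = 0.
Proof.
move=> ns; have [N hN] := adj_coef_eventually0 A.
suff h d : adj_coef A (s + N - d) = 0 \/ (s + N - d < n)%N.
  by case: (h N); rewrite addnK // ltnNge ns.
elim: d => [|d [IH|IH]]; first by left; apply: hN; rewrite subn0 leq_addl.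
  case: (leqP n (s + N - d.+1)) => hd; [left|by right].
  have [e|e] := posnP (s + N - d)%N.
    by rewrite (_ : s + N - d.+1 = s + N - d)%N // subnS e.
  have := mul_adj_coef A (s + N - d); rewrite IH mulmx0 -(prednK e) subnS /=.
  rewrite [(char_poly A)`__]nth_default; last by rewrite size_char_poly ltnS -subnS.
  by rewrite raddf0 subr0 => <-.
by right; apply: leq_ltn_trans IH; rewrite subnS leq_pred.
Qed.

Lemma adj_coef_pred n (A : 'M[R]_n.+1) : adj_coef A n = 1%:M.
Proof.
have := mul_adj_coef A n.+1; rewrite adj_coef_ge // mulmx0.
have /monicP := char_poly_monic A; rewrite lead_coefE size_char_poly /= => ->.
by move/esym/eqP; rewrite subr_eq0 => /eqP.
Qed.

(** This takes the place of Newton's identities: no eigenvalues and no division. *)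
Lemma tr_adj_coef n (A : 'M[R]_n) s : \tr (adj_coef A s) = (char_poly A)`_s.+1 *+ s.+1.
Proof.
by rewrite -coef_deriv deriv_char_poly coef_sum; apply: eq_bigr => i _; rewrite mxE.
Qed.

Fixpoint fl_mx n (A : 'M[R]_n) t : 'M[R]_n :=
  if t is t'.+1 then t%:R *: (A *m fl_mx A t') - \tr (fl_mx A t') *: A else A.

Lemma fl_mxS n (A : 'M[R]_n) t :
  fl_mx A t.+1 = t.+1%:R *: (A *m fl_mx A t) - \tr (fl_mx A t) *: A.
Proof. by []. Qed.

Lemma mul_adj_coefS n (A : 'M[R]_n.+1) t : (t < n)%N ->
  adj_coef A (n - t.+1) = A *m adj_coef A (n - t) + ((char_poly A)`_(n - t))%:M.
Proof.
by move=> tn; rewrite -(subnSK tn) mul_adj_coef subrK.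
Qed.

(** With c the coefficient of index n - t, traces in [mul_adj_coefS] give (n - t) c for the left
    side and (n + 1) c for the scalar matrix; the difference is -(t + 1) c. *)
Lemma tr_mul_adj_coef n (A : 'M[R]_n.+1) t : (t < n)%N ->
  \tr (A *m adj_coef A (n - t)) = - ((char_poly A)`_(n - t) *+ t.+1).
Proof.
move=> tn; have := mul_adj_coefS A tn => /(congr1 mxtrace).
rewrite mxtraceD mxtrace_scalar tr_adj_coef subnSK // => /eqP.
rewrite -subr_eq => /eqP <-; rewrite -opprB -mulrnBr; last by rewrite (leq_trans (leq_subr t n)).
by congr (- (_ *+ _)); rewrite subSn ?leq_subr // subKn // ltnW.
Qed.

(** The invariant of the recursion. The trace term contributes (t+1)! c A, with c the coefficient of
    index n - t, which is what turns A times one adjugate coefficient into the next. *)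
Lemma fl_mxE n (A : 'M[R]_n.+1) t : (t <= n)%N ->
  fl_mx A t = t`!%:R *: (A *m adj_coef A (n - t)).
Proof.
elim: t => [|t IH] ht; first by rewrite subn0 adj_coef_pred mulmx1 scale1r.
rewrite fl_mxS (IH (ltnW ht)) (mul_adj_coefS A ht) mxtraceZ (tr_mul_adj_coef A ht).
rewrite factS natrM mulmxDr mul_mx_scalar -scalemxAr scalerA scalerDr scalerA mulrN scaleNr opprK.
by congr (_ *: _ + _ *: _); rewrite -[_ *+ _]mulr_natl; ring.
Qed.

(** At t = n the invariant involves the constant term of the adjugate identity, where [char_poly A]
    takes the value (-1)^(n+1) det A. *)
Lemma fl_mx_det n (A : 'M[R]_n.+1) :
  fl_mx A n = ((-1) ^+ n * n`!%:R * \det A)%:M.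
Proof.
rewrite fl_mxE // subnn mul_adj_coef sub0r char_poly_det -scaleN1r scalerA.
rewrite scale_scalar_mx exprS; congr (scalar_mx _); ring.
Qed.
End FaddeevLeVerrier.

(** * Common multiples and size of determinants *)
Section Bounds.

(* Leibniz' harmonic triangle: 1/((n+1) C(n,k)) is an integral combination of 1/1, ..., 1/(n+1). *)
Lemma leibniz_triangle_dvd N x : (forall d, 0 < d <= N -> d %| x) ->
  forall k n, k <= n -> n < N -> n.+1 * 'C(n, k) %| x.
Proof.
move=> h; elim=> [|k IH] n kn nN; first by rewrite bin0 muln1 h.
case: n kn nN => // n; rewrite ltnS => kn nN.
have /dvdnP[p hp] := IH n kn (ltnW nN); have /dvdnP[q hq] := IH n.+1 (leqW kn) nN.
have := mul_bin_left n.+1 k; have := mul_bin_diag n.+1 k; rewrite /= => e1 e2.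
have c0 : 0 < 'C(n.+1, k) by rewrite bin_gt0 leqW.
have c1 : 0 < 'C(n.+1, k.+1) by rewrite bin_gt0.
have a0 : 0 < 'C(n, k) by rewrite bin_gt0.
move: hp hq e1 e2 c0 c1 a0; set a := 'C(n, k); set c := 'C(n.+1, k); set c' := 'C(n.+1, k.+1).
rewrite subSn //; move: (subnKC kn); set d := n - k => nd hp hq e1 e2 c0 c1 a0.
(* The triangle rule 1/((n+2) C(n+1,k+1)) = 1/((n+1) C(n,k)) - 1/((n+2) C(n+1,k)), multiplied by
   x. *)
apply/dvdnP; exists (p - q).
have lt : q <= p.
  rewrite -(leq_pmul2r (m := n.+2 * c)) ?muln_gt0 ?c0 // -hq hp leq_mul2l.
  by rewrite e1 e2 -nd; apply/orP; right; nia.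
apply/eqP; rewrite -(eqn_pmul2r (m := k.+1 * c)) ?muln_gt0 ?c0 //; apply/eqP.
have e3 : x * (n.+2 * c) = x * (k.+1 * c) + x * (d.+1 * c).
  by rewrite -mulnDr -mulnDl -nd; congr (_ * (_ * _)); lia.
have : (p - q) * (n.+2 * c') * (k.+1 * c) + x * (d.+1 * c) = x * (n.+2 * c).
  have -> : (p - q) * (n.+2 * c') * (k.+1 * c) = (p - q) * ((n.+2 * c) * (k.+1 * c')) by ring.
  rewrite mulnBl {2}hq.
  have -> : p * (n.+2 * c * (k.+1 * c')) = x * (n.+2 * c) by rewrite hp -e1; ring.
  have -> : q * (n.+2 * c * (k.+1 * c')) = x * (d.+1 * c) by rewrite hq -e2; ring.
  rewrite -hq subnK //; by rewrite leq_mul2l leq_mul2r -nd; apply/orP; right; apply/orP; right; lia.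
rewrite e3 => /addIn ->; done.
Qed.

Lemma exp2_le_central_bin h : 2 ^ h <= 'C(h.*2, h).
Proof.
elim: h => // h IH; rewrite doubleS expnS mul2n.
apply: (@leq_trans ('C(h.*2, h).*2)); first by rewrite leq_double.
by rewrite binS -addnn leq_add ?leq_bin2l // binS leq_addl.
Qed.

(** The middle entry of row 2h in the triangle makes C(2h,h) divide x; this bounds the least common
    multiple from below without any prime number estimate. *)
Lemma common_multiple_ge N h x : h.*2 < N -> 0 < x ->
  (forall d, 0 < d <= N -> d %| x) -> 2 ^ h <= x.
Proof.
move=> hN x0 hx; apply: leq_trans (exp2_le_central_bin h) _.
apply: dvdn_leq x0 _; apply: dvdn_trans (leibniz_triangle_dvd hx _ hN); first exact: dvdn_mull.
by rewrite -addnn leq_addr.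
Qed.

Lemma fact_le_exp2 n : n`! <= 2 ^ (n * n).
Proof.
have [->|n0] := posnP n; first by [].
apply: (@leq_trans (n ^ n)); last first.
  by rewrite expnM leq_exp2r // ltnW // ltn_expl.
rewrite -ffactnn ffact_prod -[X in n ^ X](card_ord n) -prod_nat_const.
by apply: leq_prod => i _; apply: leq_subr.
Qed.

Lemma det_abs_le n (A : 'M[int]_n) B :
  (forall i j, `|A i j| <= B)%N -> (`|(\det A)%R| <= n`! * B ^ n)%N.
Proof.
move=> h; have: (`|\det A| <= \sum_(s : 'S_n) (B ^ n)%N%:Z)%R.
  apply: le_trans (ler_norm_sum _ _ _) _; apply: ler_sum => s _.
  rewrite normrM normr_sign mul1r normr_prod.
  have -> : ((B ^ n)%N%:Z = \prod_(i < n) B%:Z)%R by rewrite prodr_const card_ord -natz natrX natz.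
  by apply: ler_prod => i _; rewrite normr_ge0 /= -abszE lez_nat.
by rewrite sumr_const card_Sn -abszE -mulr_natl natz -PoszM lez_nat.
Qed.

Lemma binary_expansion K n : n < 2 ^ K -> \sum_(s < K) odd (n %/ 2 ^ s) * 2 ^ s = n.
Proof.
(* Stated for n modulo 2^K, the claim needs no bound on n and goes through by induction on K. *)
move=> h; rewrite -[RHS](modn_small h) {h}; elim: K => [|K IH]; first by rewrite big_ord0 modn1.
rewrite big_ord_recr /= IH; set q := n %/ 2 ^ K.
have r2 : odd q * 2 ^ K + n %% 2 ^ K < 2 ^ K.+1.
  have := ltn_pmod n (expn_gt0 2 K); rewrite expnS; case: (odd q); lia.
have -> : n %% 2 ^ K.+1 = (q./2 * 2 ^ K.+1 + (odd q * 2 ^ K + n %% 2 ^ K)) %% 2 ^ K.+1.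
  congr (_ %% _); rewrite [LHS](divn_eq n (2 ^ K)) -/q -[in LHS](odd_double_half q) -mul2n expnS.
  by rewrite mulnDl addnCA addnA -mulnA mulnCA.
by rewrite modnMDl (modn_small r2) addnC.
Qed.

End Bounds.

(** * Correctness *)
Section Correctness.
Variables (I : finType) (k : nat) (M : I -> I -> int).
Hypothesis Mk : bits_suffice k M.

Notation A := (mxstructure k M).

Lemma card_ord_lt n (s : 'I_n) : #|[set t : 'I_n | t < s]| = s.
Proof.
have h : s <= n := ltnW (ltn_ord s).
rewrite -[RHS]card_ord -cardsT -(card_imset [set: 'I_s] (f := widen_ord h)); last first.
  by move=> x y /(congr1 val) /= /val_inj.
apply: eq_card => t; rewrite inE; apply/idP/imsetP => [lt|[x _ ->]]; last exact: (ltn_ord x).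
by exists (Ordinal lt) => //; apply: val_inj.
Qed.

Lemma abs_residueE (i j : I) m : abs_residue (A := A) i j m = `|M i j|%N %% m.+1.
Proof.
rewrite -[in RHS](binary_expansion (Mk i j)) /abs_residue -[LHS]modn_summ -[RHS]modn_summ.
congr (_ %% _); apply: eq_bigr => s _.
rewrite /bitof /= /binary_digit; case: odd; rewrite ?mul0n ?mod0n // mul1n modn_mod.
congr (2 ^ _ %% _); exact: card_ord_lt.
Qed.

Lemma entry_residueE (i j : I) m :
  ((entry_residue (A := A) i j m)%:Z = (M i j %% m.+1)%Z)%R.
Proof.
rewrite /entry_residue !abs_residueE /positive /=; case: ifP => h.
  by rewrite -modz_nat gtz0_abs.
rewrite modnMmr -modz_nat PoszM lez0_abs; last by rewrite leNgt h.
apply/eqP; rewrite eqz_mod_dvd mulrN -opprD -{2}[M i j]mul1r -mulrDl -PoszD addn1.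
by rewrite rpredN dvdz_mulr.
Qed.

(** An integer recursion indexed by [I] itself, linking the residues over [I] to [fl_mx], which
    requires ordinal indices. *)
Fixpoint fl (t : nat) : I -> I -> int :=
  if t is t'.+1 then fun i j =>
    (t%:Z * (\sum_l M i l * fl t' l j) - (\sum_l fl t' l l) * M i j)%R
  else M.

Lemma modz_cong_sum (T : finType) (d : int) (F G : T -> int) :
  (forall l, (F l = G l %[mod d])%Z) -> ((\sum_l F l)%R = (\sum_l G l)%R %[mod d])%Z.
Proof.
move=> h; apply: (big_ind2 (fun x y => (x = y %[mod d])%Z)) => //.
by move=> x1 x2 y1 y2 e1 e2; rewrite -modzDm e1 e2 modzDm.
Qed.

Lemma fl_residueE t (i j : I) m : ((fl_residue (A := A) m t i j)%:Z = (fl t i j %% m.+1)%Z)%R.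
Proof.
elim: t i j => [|t IH] i j /=; first exact: entry_residueE.
(* A congruence rule for each operation of [fl_step]; the goal then follows along its syntax. *)
have cM (x y x' y' d : int) : (x = x' %[mod d])%Z -> (y = y' %[mod d])%Z -> ((x * y)%R = (x' * y')%R %[mod d])%Z.
  by move=> e1 e2; rewrite -modzMm e1 e2 modzMm.
have cE (i0 j0 : I) : ((entry_residue (A := A) i0 j0 m)%:Z = M i0 j0 %[mod m.+1])%Z.
  by rewrite entry_residueE modz_mod.
have cU (i0 j0 : I) : ((fl_residue (A := A) m t i0 j0)%:Z = fl t i0 j0 %[mod m.+1])%Z.
  by rewrite IH modz_mod.
have cN (n : nat) (x : int) : (n%:Z = x %[mod m.+1])%Z -> ((n %% m.+1)%:Z = x %[mod m.+1])%Z.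
  by rewrite -modz_nat modz_mod.
have cS (F : I -> nat) (G : I -> int) : (forall l, (F l)%:Z = G l %[mod m.+1])%Z ->
    ((\sum_l F l)%N%:Z = (\sum_l G l)%R %[mod m.+1])%Z.
  by move=> h; rewrite (big_morph Posz PoszD (erefl 0%Z)); apply: modz_cong_sum.
have cm (x y : int) : (x = y %[mod m.+1])%Z -> ((m%:Z * x)%R = (- y)%R %[mod m.+1])%Z.
  move=> h; apply: etrans (_ : ((-1) * y)%R %% m.+1 = _)%Z; last by rewrite mulN1r.
  by apply: (cM) (h); apply/eqP; rewrite eqz_mod_dvd opprK -PoszD addn1 dvdzz.
rewrite /fl_step -modz_nat PoszD -modzDm -[RHS]modzDm; congr ((_ + _) %% _)%Z.
  apply: (cN); rewrite PoszM; apply: (cM) => //; apply: (cN); apply: cS => l.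
  by apply: (cN); rewrite PoszM; apply: (cM).
apply: (cN); rewrite PoszM -mulNr; apply: (cM) => //; apply: (cN); rewrite PoszM; apply: cm.
by apply: (cN); apply: cS.
Qed.

Lemma fl_mx_enum t (x y : 'I_#|I|) :
  fl_mx (\matrix_(i, j) M (enum_val i) (enum_val j))%R t x y = fl t (enum_val x) (enum_val y).
Proof.
set Mx := (\matrix_(i, j) _)%R.
have re (F : I -> int) : (\sum_l F l)%R = (\sum_(z < #|I|) F (enum_val z))%R.
  by rewrite (reindex _ (onW_bij _ (enum_val_bij I))).
elim: t x y => [|t IH] x y; first by rewrite /= mxE.
rewrite fl_mxS !mxE /= !re -natz; congr (_ * _ - _ * _)%R.
  by apply: eq_bigr => z _; rewrite IH mxE.
by apply: eq_bigr => z _; rewrite IH.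
Qed.

Lemma fl_diag (i : I) :
  (fl #|I|.-1 i i = (-1) ^+ #|I|.-1 * (#|I|.-1)`!%:R * idet M)%R.
Proof.
have n0 : 0 < #|I| by apply/card_gt0P; exists i.
have h n (B : 'M[int]_n) : 0 < n -> (fl_mx B n.-1 = ((-1) ^+ n.-1 * (n.-1)`!%:R * \det B)%:M)%R.
  by case: n B => // n B _; apply: fl_mx_det.
by rewrite -(enum_rankK i) -fl_mx_enum (h _ _ n0) mxE eqxx mulr1n.
Qed.

Lemma universe_card_mx : universe_card A = #|I| + k.+1.
Proof.
rewrite /universe_card (bigD1 IndexSort) //= (bigD1 BitSort) //= big1 ?addn0 ?card_ord //.
by case.
Qed.

(** The exponent collects n^2 for (n-1)!, n^2 for the n! terms of the determinant and n(k+1) for a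
    product of n entries; the successor makes the bound strict. *)
Lemma fl_diag_lt (i : I) : `|fl #|I|.-1 i i|%N < 2 ^ (#|I| * (2 * #|I| + k.+1)).+1.
Proof.
rewrite fl_diag; set n := #|I|.
have -> : `|((-1) ^+ n.-1 * (n.-1)`!%:R * idet M)%R|%N = (n.-1)`! * `|idet M|%N.
  by rewrite !abszM abszX /= exp1n mul1n natz.
have hd : `|idet M|%N <= n`! * (2 ^ k.+1) ^ n.
  by apply: det_abs_le => x y; rewrite mxE ltnW.
apply: (@leq_ltn_trans (2 ^ (n * n) * (2 ^ (n * n) * (2 ^ k.+1) ^ n))); last first.
  by rewrite -expnM -!expnD ltn_exp2l // ltnS mulnDr; lia.
apply: leq_mul; first by apply: leq_trans (fact_le_exp2 n); apply/leq_fact/leq_pred.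
by apply: leq_trans hd _; rewrite leq_mul2r fact_le_exp2 orbT.
Qed.

Lemma nonsingular_testP : nonsingular_test A <-> idet M <> 0%R.
Proof.
have cI (i : I) : #|[set j | j != i]| = #|I|.-1.
  by rewrite -(cardsC1 i); congr #|pred_of_set _|; apply/setP => j; rewrite !inE.
split=> [/forallP h d0|dn].
  (* The determinant of the empty matrix is 1, so a vanishing one provides an index at which to use
     the test. *)
  have n0 : 0 < #|I|.
    rewrite lt0n; apply/eqP => e; move: d0; rewrite /idet.
    by move: (@enum_val I predT); rewrite -[#|predT|]/#|I| e => f; rewrite det_mx00.
  have /card_gt0P[i _] := n0; have /existsP[m /eqP] := h i; apply.
  by apply/eqP; rewrite -eqz_nat fl_residueE cI fl_diag d0 mulr0 mod0z.
apply/forallP => i; apply/existsP.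
have [m|] := pickP (fun m : stuple (dom A) num => fl_residue (numval m) #|[set j | j != i]| i i != 0 :> nat).
  by exists m.
move=> h0; exfalso.
have x0 : 0 < `|fl #|I|.-1 i i|%N.
  by rewrite absz_gt0 fl_diag !mulf_neq0 ?expf_neq0 // ?pnatr_eq0 -?lt0n ?fact_gt0 //; apply/eqP.
have := fl_diag_lt i; rewrite ltnNge => /negP; apply.
apply: (@common_multiple_ge (nbound A)) => // [|d /andP[d0 dN]].
  (* With n = |I| and b = n + k + 2, this is 2(n(2n + k + 1) + 1) < b^3. *)
  rewrite /nbound /base universe_card_mx !expnS expn0; nia.
(* A divisor d is represented by d - 1, so d = b^3 is still within range. *)
have [m hm] : exists m, @numval _ A m = d.-1 by apply: numval_surj; rewrite prednK.
have := h0 m; rewrite hm => /negbFE; rewrite -eqz_nat fl_residueE cI prednK // => /eqP/dvdz_mod0P.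
by [].
Qed.
End Correctness.

Theorem mainTheorem12 :
  exists phi : sentence mxvoc,
    forall (I : finType) (k : nat) (M : I -> I -> int),
      bits_suffice k M ->
      (satisfies (mxstructure k M) phi <-> idet M <> 0%R).
Proof.
have [phi h] := nonsingular_test_definable.
by exists phi => I k M Mk; rewrite h; apply: nonsingular_testP.
Qed.
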